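(* Every Fraïssé category has a Fraïssé limit.
   Context: Approximate isometries. For metric spaces $X,Y$, an approximate isometry from $X$ to $Y$ is a map $\varphi\colon X\times Y\to[0,\infty]$ such that, in each variable separately, the resulting map $g$ satisfies $g(u)\le d(u,u')+g(u')$ and $d(u,u')\le g(u)+g(u')$; $\operatorname{Apx}(X,Y)$ is the set of these, ordered pointwise, with the topology of pointwise convergence. For (partial) isometries $\iota,\eta$ into a common space, $\varphi_{\iota,\eta}(x,y):=d(\iota(x),\eta(y))$; $\varphi_\iota(x,y):=d(\iota(x),y)$. For $X'\subseteq X,Y'\subseteq Y$ and an approximate isometry $\psi$ from $X'$ to $Y'$, $\psi|^{X\times Y}(x,y):=\inf_{x'\in X',y'\in Y'}(d(x,x')+\psi(x',y')+d(y',y))$. Write $\psi\vartriangleleft\varphi$ if $\psi$ is in the interior of $\{\psi':\psi'\le\varphi\}$ in $\operatorname{Apx}(X,Y)$. Structures. $L$-structures are complete metric spaces with continuous interpretations of the relation (real-valued) and function symbols of a language $L$; $L$-embeddings are isometries preserving relations and commuting with functions; $\langle E\rangle$ is the generated substructure; $\bar a$ is an ordered generator of $\mathcal{A}$ if its entries generate $\mathcal{A}$. $\mathscr{K}$ is a category of finitely generated separable $L$-structures with $L$-embeddings ($\mathscr{K}$-embeddings) as morphisms. A joint $\mathscr{K}$-embedding is a pair of $\mathscr{K}$-embeddings into a common object. JEP: any two objects have a joint $\mathscr{K}$-embedding. NAP: for objects $\mathcal{A},\mathcal{B}_1,\mathcal{B}_2$, $\mathscr{K}$-embeddings $\iota_i\colon\mathcal{A}\to\mathcal{B}_i$,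 finite $F\subseteq|\mathcal{A}|$, $\varepsilon>0$, there is a joint $\mathscr{K}$-embedding $(\eta_1,\eta_2)$ of $\mathcal{B}_1,\mathcal{B}_2$ with $d(\eta_1\iota_1(a),\eta_2\iota_2(a))<\varepsilon$ on $F$. A finite partial $\mathscr{K}$-isomorphism $\iota\colon\mathcal{A}\dashrightarrow\mathcal{C}$ is an isometry between finite subsets with $\langle\operatorname{dom}\iota\rangle,\langle\operatorname{ran}\iota\rangle$ objects whose inclusions are $\mathscr{K}$-embeddings and such that $\iota$ extends to a $\mathscr{K}$-isomorphism between them. $\operatorname{Apx}_{2,\mathscr{K}}(\mathcal{A},\mathcal{B})$ is the set of $\varphi_{\iota,\eta}|^{|\mathcal{A}|\times|\mathcal{B}|}$ for finite partial $\mathscr{K}$-isomorphisms $\iota\colon\mathcal{A}\dashrightarrow\mathcal{C}$, $\eta\colon\mathcal{B}\dashrightarrow\mathcal{C}$. A $\mathscr{K}$-structure is an $L$-structure $\mathcal{M}$ with a sequence of $\mathscr{K}$-embeddings $\mathcal{A}_1\to\mathcal{A}_2\to\cdots$ with inductive limit $\mathcal{M}=\overline{\bigcup_n\mathcal{A}_n}$. For $\mathcal{M}=\overline{\bigcup_n\mathcal{A}_n}$, $\mathcal{N}=\overline{\bigcup_m\mathcal{B}_m}$, $\operatorname{Apx}_\mathscr{K}(\mathcal{M},\mathcal{N})$ is the closure in $\operatorname{Apx}(|\mathcal{M}|,|\mathcal{N}|)$ of all $\psi$ with $\psi\ge\varphi|^{|\mathcal{M}|\times|\mathcal{N}|}$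 for some $n,m$ and $\varphi\in\operatorname{Apx}_{2,\mathscr{K}}(\mathcal{A}_n,\mathcal{B}_m)$; $\operatorname{Stx}_\mathscr{K}(\mathcal{M},\mathcal{N})$ is the set of $\varphi\in\operatorname{Apx}_\mathscr{K}(\mathcal{M},\mathcal{N})$ for which some $\psi\in\operatorname{Apx}_\mathscr{K}(\mathcal{M},\mathcal{N})$ satisfies $\psi\vartriangleleft\varphi$. An $L$-embedding $\iota$ is $\mathscr{K}$-admissible if $\varphi_\iota\in\operatorname{Apx}_\mathscr{K}$. $\mathscr{K}_n$ is the class of pairs $\langle\mathcal{A},\bar a\rangle$ with $\bar a=(a_1,\dots,a_n)$ an ordered generator of the object $\mathcal{A}$, with pseudo-metric $d^\mathscr{K}(\langle\bar a\rangle,\langle\bar b\rangle):=\inf\{\max_i d(\iota(a_i),\eta(b_i))\}$ over joint $\mathscr{K}$-embeddings $(\iota,\eta)$. WPP: each $(\mathscr{K}_n,d^\mathscr{K})$ is separable. CCP: for each $n$-ary relation symbol $P$ the map $\langle\mathcal{A},(\bar a,\bar b)\rangle\mapsto P^\mathcal{A}(\bar a)$ on $\mathscr{K}_{n+m}$, and for each $n$-ary function symbol $f$ the map $\langle\mathcal{A},(\bar a,\bar b)\rangle\mapsto\langle\mathcal{A},(\bar a,\bar b,f^\mathcal{A}(\bar a))\rangle$, send $d^\mathscr{K}$-Cauchy sequences to Cauchy sequences. A Fraïssé category is such a category satisfying JEP, NAP, WPP and CCP. A Fraïssé limit of $\mathscr{K}$ is a $\mathscr{K}$-structure $\mathcal{M}$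 such that for every $\mathscr{K}$-structure $\mathcal{N}$ and $\varphi\in\operatorname{Stx}_\mathscr{K}(\mathcal{N},\mathcal{M})$ there is a $\mathscr{K}$-admissible embedding $\iota\colon\mathcal{N}\to\mathcal{M}$ with $\varphi_\iota\vartriangleleft\varphi$.
   Formalization: The formal theorem additionally assumes that every sequence of 𝒦-embeddings A_1→A_2→⋯ has an inductive limit that is an L-structure (without this the claim is false) and that 𝒦 has at least one object. *)

(* Defs.v *)
From HB Require Import structures.
From mathcomp Require Import all_boot all_order all_algebra.
From mathcomp Require Import all_classical all_reals all_analysis.

Set Implicit Arguments.
Unset Strict Implicit.
Unset Printing Implicit Defensive.

Import Order.TTheory GRing.Theory Num.Theory.
Import numFieldTopology.Exports.

Local Open Scope classical_set_scope.
Local Open Scope ring_scope.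

Section ApproximateIsometries.
Context {R : realType}.
Local Open Scope ereal_scope.

Definition katetov (X : metricType R) (g : X -> \bar R) : Prop :=
  forall u v, g u <= (mdist u v)%:E + g v /\ (mdist u v)%:E <= g u + g v.

(* The carrier [{ptws X * Y -> \bar R}] supplies the topology of pointwise
   convergence. *)
Definition apx (X Y : metricType R) : set {ptws (X * Y) -> \bar R} :=
  [set phi | [/\ forall p, 0 <= phi p,
                 forall y, katetov (fun x => phi (x, y)) &
                 forall x, katetov (fun y => phi (x, y))]].

Definition apx_le (X Y : Type) (psi phi : X * Y -> \bar R) : Prop :=
  forall p, psi p <= phi p.

Definition apx_of (X Y : Type) (Z : metricType R) (iota : X -> Z) (eta : Y -> Z)
    : X * Y -> \bar R :=
  fun p => (mdist (iota p.1) (eta p.2))%:E.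

Arguments apx X Y _ : clear implicits.

(* Largest extension of [psi] from [X' * Y'] to [X * Y], where [X'] and [Y'] are
   regarded as subspaces of [X] and [Y] through [i] and [j]. *)
Definition apx_ext (X Y : metricType R) (X' Y' : Type) (i : X' -> X) (j : Y' -> Y)
    (psi : X' * Y' -> \bar R) : X * Y -> \bar R :=
  fun p => ereal_inf
    (range (fun q => (mdist p.1 (i q.1))%:E + psi q + (mdist (j q.2) p.2)%:E)).

(* [psi] belongs to the interior of [psi' <= phi] relative to [apx X Y]. *)
Definition apx_lhd (X Y : metricType R) (psi phi : {ptws (X * Y) -> \bar R})
    : Prop :=
  apx X Y psi /\
  \forall psi' \near psi, apx X Y psi' -> apx_le psi' phi.

End ApproximateIsometries.

Arguments apx {R} X Y _.

Record language := Language {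
  rel_symb : Type;
  rel_arity : rel_symb -> nat;
  fun_symb : Type;
  fun_arity : fun_symb -> nat }.

(* Completeness is spelled out because the library's [completeType] is pointed,
   whereas a structure over a language without constants may be empty. *)
Record structure (R : realType) (L : language) := Structure {
  carrier :> metricType R;
  carrier_complete : forall F : set_system carrier,
    ProperFilter F -> cauchy F -> exists l : carrier, F --> l;
  rel_interp : forall P : rel_symb L,
    {ptws 'I_(rel_arity P) -> carrier} -> R;
  fun_interp : forall f : fun_symb L,
    {ptws 'I_(fun_arity f) -> carrier} -> carrier;
  rel_interp_continuous : forall P, continuous (@rel_interp P);
  fun_interp_continuous : forall f, continuous (@fun_interp f) }.

Arguments rel_interp {R L s} P _.
Arguments fun_interp {R L s} f _.

Section Structures.
Context {R : realType} {L : language}.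
Implicit Types A B M : structure R L.

Definition is_embedding A B (e : A -> B) : Prop :=
  [/\ forall x y, mdist (e x) (e y) = mdist x y,
      forall (P : rel_symb L) a, rel_interp P (e \o a) = rel_interp P a &
      forall (f : fun_symb L) a, fun_interp f (e \o a) = e (fun_interp f a)].

(* Substructures are complete, hence closed. *)
Definition generated A (E : set A) : set A :=
  \bigcap_(S in [set S : set A |
    [/\ closed S, E `<=` S &
        forall (f : fun_symb L) (a : 'I_(fun_arity f) -> A),
          (forall i, S (a i)) -> S (fun_interp f a)]]) S.

Definition ordered_generator A n (a : 'I_n -> A) : Prop :=
  generated (range a) = setT.

Definition finitely_generated A : Prop :=
  exists n (a : 'I_n -> A), ordered_generator a.

Definition separable A : Prop := exists2 D : set A, countable D & dense D.

Definition inductive_limit (A : nat -> structure R L)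
    (f : forall n, A n -> A n.+1) M (incl : forall n, A n -> M) : Prop :=
  [/\ forall n, is_embedding (incl n),
      forall n x, incl n.+1 (f n x) = incl n x &
      dense (\bigcup_n range (incl n))].

End Structures.

(* [obj], [Kn] and the dense family in [WPP] avoid the library's [set], whose
   universe is too small to contain [structure R L]. *)
Record category (R : realType) (L : language) := Category {
  obj : structure R L -> Prop;
  hom : forall A B : structure R L, set (A -> B);
  obj_fg : forall A, obj A -> finitely_generated A;
  obj_separable : forall A, obj A -> separable A;
  hom_obj : forall (A B : structure R L) (f : A -> B), hom f -> obj A /\ obj B;
  hom_embedding : forall (A B : structure R L) (f : A -> B), hom f -> is_embedding f;
  hom_id : forall A, obj A -> hom (fun x : A => x);
  hom_comp : forall (A B C : structure R L) (f : A -> B) (g : B -> C),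
    hom f -> hom g -> hom (g \o f) }.

Arguments hom {R L} c {A B} _.

Section Category.
Context {R : realType} {L : language} (K : category R L).
Implicit Types A B C D : structure R L.

Definition joint_hom A B C (iota : A -> C) (eta : B -> C) : Prop :=
  hom K iota /\ hom K eta.

Definition iso A B (f : A -> B) : Prop :=
  hom K f /\ exists g : B -> A, [/\ hom K g, cancel f g & cancel g f].

Definition JEP : Prop :=
  forall A B, obj K A -> obj K B ->
    exists C (iota : A -> C) (eta : B -> C), joint_hom iota eta.

Definition NAP : Prop :=
  forall A B1 B2 (iota1 : A -> B1) (iota2 : A -> B2) (F : set A) (e : R),
    hom K iota1 -> hom K iota2 -> finite_set F -> 0 < e ->
    exists C (eta1 : B1 -> C) (eta2 : B2 -> C),
      joint_hom eta1 eta2 /\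
      forall a, F a -> mdist (eta1 (iota1 a)) (eta2 (iota2 a)) < e.

(* Objects are understood up to isomorphism: a subset [S] of [A] is an object
   whose inclusion is a K-embedding when [S] is the image of a K-embedding
   [i : D -> A], through which [D] is identified with [S]. *)
Definition represents A D (i : D -> A) (S : set A) : Prop :=
  hom K i /\ range i = S.

(* The partial map is a function on its domain [S], seen as a subtype of [A]. *)
Definition finite_partial_iso A C (S : set A) (iota : S -> C) : Prop :=
  [/\ finite_set S,
      forall x y : S, mdist (iota x) (iota y) = mdist (val x) (val y) &
      exists D D' (i : D -> A) (j : D' -> C) (theta : D -> D'),
        [/\ represents i (generated S),
            represents j (generated (range iota)),
            iso theta &
            forall (x : S) (z : D), i z = val x -> j (theta z) = iota x]].

Definition apx2K A B : set (A * B -> \bar R) :=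
  [set phi | exists C (S : set A) (T : set B) (iota : S -> C) (eta : T -> C),
    [/\ finite_partial_iso iota, finite_partial_iso eta &
        phi = apx_ext val val (apx_of iota eta)]].

Record Kstructure := KStructure {
  ks_obj : nat -> structure R L;
  ks_map : forall n, ks_obj n -> ks_obj n.+1;
  ks_map_hom : forall n, hom K (@ks_map n);
  ks_lim :> structure R L;
  ks_incl : forall n, ks_obj n -> ks_lim;
  ks_limit : inductive_limit ks_map ks_incl }.

(* This does not follow from the other axioms: [CCP] below only controls
   generating tuples of a fixed length, so the interpretations on the union of a
   chain may fail to extend continuously to its completion. *)
Definition has_inductive_limits : Prop :=
  forall (A : nat -> structure R L) (f : forall n, A n -> A n.+1),
    (forall n, hom K (f n)) ->
    exists (M : structure R L) (incl : forall n, A n -> M),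
      inductive_limit f incl.

Definition apxK (M N : Kstructure) : set {ptws (M * N) -> \bar R} :=
  apx M N `&`
  closure ([set psi | apx M N psi /\
    exists n m (phi : ks_obj M n * ks_obj N m -> \bar R),
      apx2K phi /\
      apx_le (apx_ext (@ks_incl M n) (@ks_incl N m) phi) psi]
    : set {ptws (M * N) -> \bar R}).

Definition stxK (M N : Kstructure) : set {ptws (M * N) -> \bar R} :=
  [set phi | apxK phi /\ exists2 psi, apxK psi & apx_lhd psi phi].

Definition admissible (M N : Kstructure) (iota : M -> N) : Prop :=
  is_embedding iota /\
  apxK (apx_of iota (fun y : N => y) : {ptws (M * N) -> \bar R}).

Definition fraisse_limit (M : Kstructure) : Prop :=
  forall (N : Kstructure) (phi : {ptws (N * M) -> \bar R}), stxK phi ->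
    exists2 iota : N -> M,
      admissible iota & apx_lhd (apx_of iota (fun y : M => y)) phi.

Record tupled (n : nat) := Tupled {
  tup_str :> structure R L;
  tup : 'I_n -> tup_str }.

Definition Kn (n : nat) (x : tupled n) : Prop :=
  obj K x /\ ordered_generator (@tup n x).

Definition dK (n : nat) (x y : tupled n) : \bar R :=
  ereal_inf [set r | exists C (iota : x -> C) (eta : y -> C),
    joint_hom iota eta /\
    r = (\big[Num.max/0]_(i < n) mdist (iota (tup x i)) (eta (tup y i)))%:E].

Definition dK_cauchy (n : nat) (u : nat -> tupled n) : Prop :=
  forall e : R, 0 < e ->
    exists k0 : nat, forall k l : nat, (k0 <= k)%N -> (k0 <= l)%N ->
      (dK (u k) (u l) < e%:E)%E.

Definition WPP : Prop :=
  forall n, exists (I : countType) (D : I -> tupled n),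
    (forall i, Kn (D i)) /\
    (forall x e, Kn x -> 0 < e -> exists i, (dK x (D i) < e%:E)%E).

Definition tup_head (n m : nat) (x : tupled (n + m)) : 'I_n -> x :=
  fun i => tup x (lshift m i).

Definition tup_rcons (n : nat) (x : tupled n) (c : x) : tupled (n + 1) :=
  Tupled (fun i : 'I_(n + 1) =>
    match fintype.split i with inl j => tup x j | inr _ => c end).

Definition CCP : Prop :=
  (forall (P : rel_symb L) m (u : nat -> tupled (rel_arity P + m)),
    (forall k, Kn (u k)) -> dK_cauchy u ->
    cauchy ((fun k => rel_interp P (tup_head (u k))) @ \oo)) /\
  (forall (f : fun_symb L) m (u : nat -> tupled (fun_arity f + m)),
    (forall k, Kn (u k)) -> dK_cauchy u ->
    dK_cauchy (fun k => tup_rcons (fun_interp f (tup_head (u k))))).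

(* Nonemptiness is implicit in the usual terminology; over the empty category
   there is no K-structure at all. *)
Definition fraisse_category : Prop :=
  (exists A, obj K A) /\ [/\ JEP, NAP, WPP & CCP].

End Category.

(* Main.v *)
(* A K-structure is a Fraisse limit once its chain (A_s) realizes, up to any
   error and at a later stage, every configuration over A_s: an object C with a
   K-embedding A_s -> C together with a generated tuple embedded in C.  By WPP
   and NAP the configurations over one object, compared by their distance after
   amalgamation, are separable, so countably many demands suffice, and a chain
   meeting each of them is built by bookkeeping; its inductive limit is M.

   Given N and a strict phi, the witness of strictness is amalgamated into a
   joint embedding of a stage of N and a stage of M.  A back-and-forth then
   extends the stage of N by NAP and realizes the generating tuples of the
   stages of N in M, each tuple infinitely often, with summable errors.  In the
   limit this defines an isometry N -> M close to the starting joint embedding.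
   It is an embedding by CCP: each generating tuple of a stage of N is
   approximated, in the metric d^K, by tuples of the same length generating
   objects of K inside M.  The joint embeddings of the back-and-forth
   approximate its graph, which gives admissibility. *)

Require Import Defs.
From mathcomp Require Import all_boot all_order all_algebra.
From mathcomp Require Import all_classical all_reals all_analysis.
From mathcomp Require Import lra.
(* The vector library also defines [hom]; this restores the one of categories. *)
Import Defs.

Set Implicit Arguments.
Unset Strict Implicit.
Unset Printing Implicit Defensive.

Import Order.TTheory GRing.Theory Num.Theory.
Import numFieldTopology.Exports.

Local Open Scope classical_set_scope.
Local Open Scope ring_scope.

(** * Neighbourhoods in the topology of pointwise convergence *)

Section PointwiseTopology.
Context {R : realType}.

Lemma ptws_cvg_to (I : Type) (V : topologicalType) (f : {ptws I -> V})
    (G : set_system {ptws I -> V}) : Filter G ->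
  (forall i (W : set V), nbhs (f i) W -> G [set g | W (g i)]) -> nbhs f `<=` G.
Proof.
move=> FG H; suff : G --> f by [].
apply/cvg_sup => i U [V'] [[W oW <-] Wfi sub].
by apply: filterS sub _; apply: H; apply: open_nbhs_nbhs.
Qed.

Lemma ptws_nbhs_eval (I : Type) (V : topologicalType) (f : {ptws I -> V}) i
    (W : set V) : nbhs (f i) W -> nbhs f [set g | W (g i)].
Proof.
rewrite nbhsE => -[B [oB Bfi] BW].
have /cvg_sup/(_ i) : f --> f by [].
apply; exists [set g : {ptws I -> V} | B (g i)]; split => //.
  by exists B.
by move=> g /= /BW.
Qed.

Lemma near_seq (T : Type) (F : set_system T) (I : eqType) (s : seq I)
    (P : I -> T -> Prop) : Filter F ->
  (forall i, i \in s -> \forall x \near F, P i x) ->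
  \forall x \near F, forall i, i \in s -> P i x.
Proof.
move=> FF; elim: s => [_|a s IH H]; first exact: nearW.
have Ha := H a (mem_head _ _).
have Hs := IH (fun i si => H i (mem_behead (s := a :: s) si)).
apply: filterS2 Ha Hs => x Pa Ps i; rewrite inE => /orP[/eqP->//|]; exact: Ps.
Qed.

(** Uniform closeness refines pointwise closeness: the sets containing a uniform ball about [f] form
    a filter that contains every subbasic neighbourhood. *)
Lemma ptws_nbhs_mdist (I : finType) (V : metricType R) (f : {ptws I -> V}) U :
  nbhs f U -> exists2 d : R, 0 < d &
    forall g : {ptws I -> V}, (forall i, mdist (f i) (g i) < d) -> U g.
Proof.
pose G : set_system {ptws I -> V} := [set U | exists2 d : R, 0 < d &
  forall g : {ptws I -> V}, (forall i, mdist (f i) (g i) < d) -> U g].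
have FG : Filter G.
  split => [|P Q [d d0 Hd] [e e0 He]|P Q PQ [d d0 Hd]].
  - by exists 1.
  - exists (Num.min d e); first by rewrite lt_min d0.
    move=> g Hg; split; [apply: Hd|apply: He] => i.
      by have := Hg i; rewrite lt_min => /andP[].
    by have := Hg i; rewrite lt_min => /andP[].
  - by exists d => // g /Hd/PQ.
apply: (@ptws_cvg_to _ _ f G FG) => i W /nbhs_ballP[e /= e0 He].
by exists e => // g Hg; apply: He; rewrite ballEmdist /=.
Qed.

(* Translating by a small constant is the only perturbation that is needed;
   it also makes sense where [f] is infinite. *)
Lemma ptws_nbhs_translate (I : eqType) (f : {ptws I -> \bar R}) U : nbhs f U ->
  exists (s : seq I) (d : R), 0 < d /\ forall g : {ptws I -> \bar R},
    (forall i, i \in s -> g i = (f i + d%:E)%E) -> U g.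
Proof.
pose G : set_system {ptws I -> \bar R} := [set U | exists (s : seq I) (d : R),
  0 < d /\ forall e, 0 < e <= d -> forall g : {ptws I -> \bar R},
    (forall i, i \in s -> g i = (f i + e%:E)%E) -> U g].
have FG : Filter G.
  split => [|P Q [s [d [d0 Hd]]] [t [e [e0 He]]]|P Q PQ [s [d [d0 Hd]]]].
  - by exists [::], 1.
  - exists (s ++ t), (Num.min d e); split; first by rewrite lt_min d0.
    move=> r /andP[r0]; rewrite le_min => /andP[rd re] g Hg.
    split; [apply: (Hd r); rewrite ?r0 //|apply: (He r); rewrite ?r0 //];
      by move=> i si; apply: Hg; rewrite mem_cat si ?orbT.
  - by exists s, d; split => // e de g /(Hd _ de)/PQ.
suff H : nbhs f `<=` G.
  move=> /H[s [d [d0 Hd]]]; exists s, d; split => // g; apply: Hd.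
  by rewrite d0 lexx.
apply: (@ptws_cvg_to _ _ f G FG) => i W.
case fi: (f i) => [r| |]; last 2 first.
- move=> /nbhs_singleton Wi; exists [:: i], 1; split => // e _ g Hg /=.
  by rewrite (Hg i) ?inE // fi addye.
- move=> /nbhs_singleton Wi; exists [:: i], 1; split => // e _ g Hg /=.
  by rewrite (Hg i) ?inE // fi addNye.
move=> Wr; have /nbhs_ballP[e /= e0 He] : nbhs r (fun x => W x%:E) by exact: Wr.
exists [:: i], (e / 2); split; first by rewrite divr_gt0.
move=> d /andP[d0 de] g Hg /=; rewrite (Hg i) ?inE // fi -EFinD.
apply: He; rewrite /ball /= opprD addrA subrr sub0r normrN gtr0_norm //.
by lra.
Qed.

End PointwiseTopology.

(** * Extensions of approximate isometries *)

Section ApproximateIsometryExtension.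
Context {R : realType}.
Local Open Scope ereal_scope.

Definition katetov_along (X : metricType R) (X' : Type) (i : X' -> X)
    (g : X' -> \bar R) : Prop :=
  forall u v, g u <= (mdist (i u) (i v))%:E + g v /\
              (mdist (i u) (i v))%:E <= g u + g v.

(* [apx] for [X'] and [Y'] with the pseudometrics induced by [i] and [j]. *)
Definition apx_along (X Y : metricType R) (X' Y' : Type) (i : X' -> X)
    (j : Y' -> Y) (psi : X' * Y' -> \bar R) : Prop :=
  [/\ forall p, 0 <= psi p,
      forall y, katetov_along i (fun x => psi (x, y)) &
      forall x, katetov_along j (fun y => psi (x, y))].

Lemma ereal_inf_addlr (F : set (\bar R)) (a b : R) t :
  (forall z, F z -> t <= a%:E + z + b%:E) -> t <= a%:E + ereal_inf F + b%:E.
Proof.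
move=> H; rewrite -leeBlDr // [X in _ <= X]addeC -leeBlDr //.
apply: le_ereal_inf_tmp => z /H.
by rewrite leeBlDr // leeBlDr // [X in _ <= X + _]addeC.
Qed.

Lemma ereal_inf_addr (F : set (\bar R)) b t :
  (forall z, F z -> 0 <= z) -> 0 <= b ->
  (forall z, F z -> t <= z + b) -> t <= ereal_inf F + b.
Proof.
move=> F0; case: b => [b| |] // b0 H.
- by rewrite -leeBlDr //; apply: le_ereal_inf_tmp => z /H; rewrite leeBlDr.
(* Nonnegativity excludes the infimum [-oo], whose sum with [+oo] is not [+oo]. *)
- have I0 : 0 <= ereal_inf F by apply: le_ereal_inf_tmp => z /F0.
  by rewrite addey ?leey // gt_eqF // (lt_le_trans _ I0) // ltNy0.
Qed.

Section Extension.
Context {X Y : metricType R} {X' Y' : Type} (i : X' -> X) (j : Y' -> Y).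
Implicit Types (psi : X' * Y' -> \bar R) (p : X * Y).

Lemma apx_ext_le psi p q :
  apx_ext i j psi p <= (mdist p.1 (i q.1))%:E + psi q + (mdist (j q.2) p.2)%:E.
Proof. by apply: ereal_inf_lbound; exists q. Qed.

Lemma apx_ext_ge psi p t :
  (forall q, t <= (mdist p.1 (i q.1))%:E + psi q + (mdist (j q.2) p.2)%:E) ->
  t <= apx_ext i j psi p.
Proof. by move=> H; apply: le_ereal_inf_tmp => _ [q _ <-]. Qed.

Lemma apx_ext_lip psi p p' : apx_ext i j psi p <=
  (mdist p.1 p'.1)%:E + apx_ext i j psi p' + (mdist p'.2 p.2)%:E.
Proof.
apply: ereal_inf_addlr => _ [q _ <-].
apply: le_trans (apx_ext_le psi p q) _; case: (psi q) => [r| |] //=.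
rewrite -!EFinD lee_fin.
have := metric_triangle p.1 p'.1 (i q.1); have := metric_triangle (j q.2) p'.2 p.2.
by lra.
Qed.

(** A four-point inequality: [q] is moved to the second coordinate of [q'], where the Katetov lower
    bound applies. *)
Lemma apx_along_dist1 psi q q' : apx_along i j psi ->
  (mdist (i q.1) (i q'.1))%:E <= psi q + (mdist (j q.2) (j q'.2))%:E + psi q'.
Proof.
case: q q' => [x y] [x' y'] [_ k1 k2] /=.
apply: le_trans (proj2 (k1 y' x x')) _; apply: leeD => //.
by rewrite addeC metric_sym; exact: (proj1 (k2 x y' y)).
Qed.

Lemma apx_along_dist2 psi q q' : apx_along i j psi ->
  (mdist (j q.2) (j q'.2))%:E <= psi q + (mdist (i q.1) (i q'.1))%:E + psi q'.
Proof.
case: q q' => [x y] [x' y'] [_ k1 k2] /=.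
apply: le_trans (proj2 (k2 x' y y')) _; apply: leeD => //.
by rewrite addeC metric_sym; exact: (proj1 (k1 y x' x)).
Qed.

(** The Lipschitz half is [apx_ext_lip]. The other half, tested on one term of each infimum, follows
    from the four-point inequalities and triangle inequalities. *)
Lemma apx_ext_apx psi : apx_along i j psi -> apx X Y (apx_ext i j psi).
Proof.
move=> ap; have [p0 _ _] := ap.
have t0 p q : 0 <= (mdist p.1 (i q.1))%:E + psi q + (mdist (j q.2) p.2)%:E.
  by rewrite !adde_ge0 ?lee_fin ?mdist_ge0.
have e0 p : 0 <= apx_ext i j psi p by apply: apx_ext_ge => q.
split => // [y|x] u v; split.
- by have := apx_ext_lip psi (u, y) (v, y); rewrite /= mdistxx adde0.
- apply: ereal_inf_addr; [|exact: e0|] => [_ [q _ <-]|_ [q _ <-]]; first exact: t0.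
  rewrite /= addeC; apply: ereal_inf_addr; [|exact: (t0 (u, y))|] => [_ [q' _ <-]|_ [q' _ <-]].
    exact: t0.
  have := apx_along_dist1 q q' ap; have := p0 q; have := p0 q'.
  case: (psi q) (psi q') => [r| |] [r'| |] //= _ _;
    try by move=> _; exact: leey.
  rewrite -!EFinD !lee_fin.
  have := metric_triangle u (i q.1) v; have := metric_triangle (i q.1) (i q'.1) v.
  have := metric_triangle (j q.2) y (j q'.2).
  rewrite (metric_sym (i q'.1) v) (metric_sym y (j q'.2)).
  by lra.
- by have := apx_ext_lip psi (x, u) (x, v); rewrite /= mdistxx add0e addeC
    metric_sym.
- apply: ereal_inf_addr; [|exact: e0|] => [_ [q _ <-]|_ [q _ <-]]; first exact: t0.
  rewrite /= addeC; apply: ereal_inf_addr; [|exact: (t0 (x, u))|] => [_ [q' _ <-]|_ [q' _ <-]].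
    exact: t0.
  have := apx_along_dist2 q q' ap; have := p0 q; have := p0 q'.
  case: (psi q) (psi q') => [r| |] [r'| |] //= _ _;
    try by move=> _; exact: leey.
  rewrite -!EFinD !lee_fin.
  have := metric_triangle u (j q.2) v; have := metric_triangle (j q.2) (j q'.2) v.
  have := metric_triangle (i q.1) x (i q'.1).
  rewrite (metric_sym (i q.1) x) (metric_sym u (j q.2)).
  by lra.
Qed.

Lemma apx_extE psi u v : apx_along i j psi ->
  apx_ext i j psi (i u, j v) = psi (u, v).
Proof.
move=> [_ k1 k2]; apply/le_anti/andP; split.
  have := apx_ext_le psi (i u, j v) (u, v).
  by rewrite /= !mdistxx add0e adde0.
apply: apx_ext_ge => -[x y] /=.
apply: le_trans (proj1 (k1 v u x)) _; rewrite -addeA leeD2l //.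
by rewrite addeC metric_sym; exact: (proj1 (k2 x v y)).
Qed.

(** As [e1] and [e2] are isometric, the triangle inequality absorbs a detour through [X] and [Y]. *)
Lemma apx_ext_comp (Z W : metricType R) (e1 : X -> Z) (e2 : Y -> W) psi :
  (forall x y, mdist (e1 x) (e1 y) = mdist x y) ->
  (forall x y, mdist (e2 x) (e2 y) = mdist x y) ->
  apx_ext e1 e2 (apx_ext i j psi) = apx_ext (e1 \o i) (e2 \o j) psi.
Proof.
move=> h1 h2; apply/funext => p; apply/le_anti/andP; split.
  apply: le_ereal_inf_tmp => _ [q _ <-] /=.
  apply: le_trans (ereal_inf_lbound _) _.
    by exists (i q.1, j q.2).
  rewrite /= leeD2r // leeD2l //.
  have := apx_ext_le psi (i q.1, j q.2) q.
  by rewrite /= !mdistxx add0e adde0.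
apply: le_ereal_inf_tmp => _ [r _ <-] /=.
apply: ereal_inf_addlr => _ [q _ <-].
apply: le_trans (ereal_inf_lbound _) _; first by exists q.
case: (psi q) => [c| |] //=.
rewrite -!EFinD lee_fin.
have := metric_triangle p.1 (e1 r.1) (e1 (i q.1)).
have := metric_triangle (e2 (j q.2)) (e2 r.2) p.2.
by rewrite h1 h2; lra.
Qed.

Lemma apx_of_along (Z : metricType R) (iota : X' -> Z) (eta : Y' -> Z) :
  (forall x y, mdist (iota x) (iota y) = mdist (i x) (i y)) ->
  (forall x y, mdist (eta x) (eta y) = mdist (j x) (j y)) ->
  apx_along i j (apx_of iota eta).
Proof.
move=> h1 h2; split => [p|y u v|x u v]; first by rewrite lee_fin mdist_ge0.
- rewrite /apx_of /= -h1 -!EFinD !lee_fin metric_triangle.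
  by rewrite (metric_sym (iota v) (eta y)) metric_triangle.
- rewrite /apx_of /= -h2 -!EFinD !lee_fin addrC (metric_sym (eta u) (eta v)).
  rewrite metric_triangle addrC (metric_sym (iota x) (eta v)).
  by rewrite metric_triangle.
Qed.

Lemma apx_along_translate (phi : X * Y -> \bar R) (d : R) :
  apx X Y phi -> (0 <= d)%R ->
  apx_along i j (fun q => phi (i q.1, j q.2) + d%:E).
Proof.
move=> [p0 k1 k2] d0; have d0' : 0 <= d%:E by rewrite lee_fin.
have le2 (a b c : \bar R) : 0 <= a -> 0 <= b -> c <= a + b ->
    c <= a + d%:E + (b + d%:E).
  move=> a0 b0 /le_trans; apply; apply: leeD; exact: leeDl.
split => [p|y u v|x u v] /=; first exact: adde_ge0.
- by split; [rewrite addeA leeD2r // (proj1 (k1 _ _ _))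
            |apply: le2 => //; exact: (proj2 (k1 _ _ _))].
- by split; [rewrite addeA leeD2r // (proj1 (k2 _ _ _))
            |apply: le2 => //; exact: (proj2 (k2 _ _ _))].
Qed.

End Extension.

Lemma apx_lip (X Y : metricType R) (phi : X * Y -> \bar R) p p' : apx X Y phi ->
  phi p <= (mdist p.1 p'.1)%:E + phi p' + (mdist p'.2 p.2)%:E.
Proof.
move=> [_ k1 k2]; rewrite [p]surjective_pairing [p']surjective_pairing /=.
apply: le_trans (proj1 (k1 _ _ p'.1)) _; rewrite -addeA leeD2l //.
by rewrite addeC metric_sym; exact: (proj1 (k2 _ _ _)).
Qed.

(* The neighbour of [psi] is the largest approximate isometry agreeing with
   [psi + d] on the finite grid [s]. *)
Lemma apx_nbhs_ext (X Y : metricType R) (psi : {ptws (X * Y) -> \bar R})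
    (U : set {ptws (X * Y) -> \bar R}) : apx X Y psi -> nbhs psi U ->
  exists (s : seq (X * Y)) (d : R) (psi' : {ptws (X * Y) -> \bar R}),
  [/\ (0 < d)%R, apx X Y psi', U psi' & forall theta : X * Y -> \bar R,
    (forall p p', theta p <=
      (mdist p.1 p'.1)%:E + theta p' + (mdist p'.2 p.2)%:E) ->
    (forall p, p \in s -> theta p <= psi p + d%:E) -> apx_le theta psi'].
Proof.
move=> apsi /ptws_nbhs_translate[s [d [d0 H]]].
pose x k := (tnth (in_tuple s) k).1; pose y k := (tnth (in_tuple s) k).2.
pose psi' := apx_ext x y (fun q => psi (x q.1, y q.2) + d%:E).
have al := apx_along_translate x y apsi (ltW d0).
(* The indices of the two coordinates vary independently in [psi'], so [theta] has to be tested on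
   the whole grid. *)
exists [seq (p.1, p'.2) | p <- s, p' <- s], d, psi'; split => //.
- exact: apx_ext_apx.
- apply: H => q qs.
  have -> : q = (x (Ordinal (etrans (index_mem _ _) qs)),
               y (Ordinal (etrans (index_mem _ _) qs))).
    by rewrite /x /y -surjective_pairing (tnth_nth q) /= nth_index.
  by rewrite /psi' apx_extE.
- move=> theta lip le p; apply: apx_ext_ge => q.
  apply: le_trans (lip p (x q.1, y q.2)) _; apply: leeD2r; apply: leeD2l.
  by apply: le; apply/allpairsP; exists (tnth (in_tuple s) q.1, tnth (in_tuple s) q.2);
    rewrite !mem_tnth.
Qed.

End ApproximateIsometryExtension.

(** * Complete metric structures and their embeddings *)

Section MetricStructures.
Context {R : realType} {L : language}.
Implicit Types A B M N : structure R L.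

Lemma mdist_le0 (X : metricType R) (x y : X) :
  (forall e : R, 0 < e -> mdist x y <= e) -> x = y.
Proof.
move=> H; apply: mdist_positivity; apply/le_anti; rewrite mdist_ge0 andbT.
by apply/ler_addgt0Pl => e /H; rewrite addr0.
Qed.

(** [Q e x] is read as: [x] is an approximation of accuracy [e]. The sets containing all
    sufficiently fine approximations form a Cauchy filter. *)
Lemma complete_family M (Q : R -> M -> Prop) :
  (forall e, 0 < e -> exists x, Q e x) ->
  (forall d e x y, 0 < d -> 0 < e -> Q d x -> Q e y -> mdist x y <= d + e) ->
  exists l, forall e x, 0 < e -> Q e x -> mdist x l <= e.
Proof.
move=> Qex Qdist.
pose F : set_system M := [set U | exists2 e, 0 < e &
  forall d x, 0 < d <= e -> Q d x -> U x].
have FF : ProperFilter F.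
  split=> [[e e0 /(_ e)]|]; first by case: (Qex e e0) => x Qx /(_ x); apply; rewrite ?e0 ?lexx.
  split=> [|U V [d d0 Hd] [e e0 He]|U V UV [e e0 He]].
  - by exists 1.
  - exists (Num.min d e); first by rewrite lt_min d0.
    move=> c x /andP[c0]; rewrite le_min => /andP[cd ce] Qx.
    by split; [apply: (Hd c)|apply: (He c)]; rewrite ?c0.
  - by exists e => // d x de Qx; apply/UV/(He d).
have FC : cauchy F.
  apply/cauchyP => e e0; have e4 : 0 < e / 4 by rewrite divr_gt0.
  have [x Qx] := Qex _ e4; exists x, (e / 4) => // d y /andP[d0 de] Qy.
  rewrite ballEmdist /=; have := Qdist _ _ _ _ e4 d0 Qx Qy; lra.
have [l Fl] := carrier_complete FF FC.
exists l => e x e0 Qx; apply/ler_addgt0Pl => h h0.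
have h2 : 0 < h / 2 by rewrite divr_gt0.
have [d d0 Hd] := Fl _ (nbhsx_ballx l _ h2).
pose c := Num.min d (h / 2).
have c0 : 0 < c by rewrite lt_min d0.
have [y Qy] := Qex _ c0.
have := Hd c y; rewrite c0 ge_min lexx => /(_ isT Qy); rewrite ballEmdist /=.
have := Qdist _ _ _ _ e0 c0 Qx Qy; have := metric_triangle x y l.
have : c <= h / 2 by rewrite ge_min lexx orbT.
by rewrite (metric_sym l y); lra.
Qed.

Lemma embedding_comp A B M (f : A -> B) (g : B -> M) :
  is_embedding f -> is_embedding g -> is_embedding (g \o f).
Proof.
move=> [fd fr ff] [gd gr gf]; split=> [x y|P a|h a] /=.
- by rewrite gd fd.
- by rewrite -compA gr fr.
- by rewrite -compA gf ff.
Qed.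

Lemma isometry_inj (X Y : metricType R) (f : X -> Y) :
  (forall x y, mdist (f x) (f y) = mdist x y) -> injective f.
Proof.
by move=> fd x y fxy; apply: mdist_positivity; rewrite -fd fxy mdistxx.
Qed.

Lemma isometry_continuous (X Y : metricType R) (f : X -> Y) :
  (forall x y, mdist (f x) (f y) = mdist x y) -> continuous f.
Proof.
move=> fd x U /nbhs_ballP[e /= e0 eU]; apply/nbhs_ballP; exists e => //= y.
by rewrite ballEmdist /= => xy; apply: eU; rewrite ballEmdist /= fd.
Qed.

(** Preimages of points converging to a limit point are Cauchy, and [A] is complete. *)
Lemma embedding_range_closed A B (f : A -> B) : is_embedding f ->
  closed (range f).
Proof.
move=> [fd _ _] p clp.
have [e e0||l Hl] := @complete_family A (fun e x => mdist (f x) p < e).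
- have [_ [[x _ <-]]] := clp _ (nbhsx_ballx p _ e0).
  by rewrite ballEmdist /= metric_sym; exists x.
- move=> d e x y d0 e0 xd ye; rewrite -fd.
  have := metric_triangle (f x) p (f y); rewrite (metric_sym p (f y)); lra.
exists l => //; apply: mdist_le0 => e e0.
have e2 : 0 < e / 2 by rewrite divr_gt0.
have [_ [[x _ <-]]] := clp _ (nbhsx_ballx p _ e2).
rewrite ballEmdist /= metric_sym => xp; have := Hl _ _ e2 xp; rewrite -fd.
have := metric_triangle (f l) (f x) p; rewrite (metric_sym (f l) (f x)); lra.
Qed.

Lemma generated_mono A (E F : set A) : E `<=` F ->
  generated E `<=` generated F.
Proof.
by move=> EF x Ex S [cS FS fS]; apply: Ex; split => // y /EF /FS.
Qed.

Lemma generated_superset A (E F : set A) : E `<=` F ->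
  generated E = setT -> generated F = setT.
Proof.
move=> EF ET; apply/seteqP; split => // x _.
by apply: (generated_mono EF); rewrite ET.
Qed.

Lemma generated_embedding A B (f : A -> B) (E : set A) : is_embedding f ->
  generated E = setT -> generated (f @` E) = range f.
Proof.
move=> fe ET; have [fd fr ff] := fe; apply/seteqP; split.
  move=> x; apply; split; first exact: embedding_range_closed.
    by move=> _ [y _ <-]; exists y.
  move=> h a Ha.
  have /choice[b Hb] : forall i, exists x, f x = a i.
    by move=> i; have [b _ ba] := Ha i; exists b.
  have -> : a = f \o b by apply/funext => i /=; rewrite Hb.
  by rewrite ff; exists (fun_interp h b).
move=> _ [x _ <-] S [cS ES fS].
have : generated E x by rewrite ET.
move=> /(_ (f @^-1` S)); apply; split.
- by apply: closed_comp => // y _; exact: isometry_continuous.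
- by move=> y Ey; apply: ES; exists y.
- by move=> h a Ha; rewrite /preimage /= -ff; exact: fS.
Qed.

Lemma rel_interp_close M (P : rel_symb L) a (e : R) : 0 < e ->
  exists2 d, 0 < d & forall b : 'I_(rel_arity P) -> M,
    (forall i, mdist (a i) (b i) < d) ->
    `|rel_interp P a - rel_interp P b| < e.
Proof.
move=> e0; have /ptws_nbhs_mdist[d d0 Hd] :=
  @rel_interp_continuous _ _ M P a _ (nbhsx_ballx _ _ e0).
by exists d.
Qed.

Lemma fun_interp_close M (f : fun_symb L) a (e : R) : 0 < e ->
  exists2 d, 0 < d & forall b : 'I_(fun_arity f) -> M,
    (forall i, mdist (a i) (b i) < d) ->
    mdist (fun_interp f a) (fun_interp f b) < e.
Proof.
move=> e0; have /ptws_nbhs_mdist[d d0 Hd] :=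
  @fun_interp_continuous _ _ M f a _ (nbhsx_ballx _ _ e0).
by exists d => // b /Hd /=; rewrite ballEmdist.
Qed.

End MetricStructures.

(** * The pseudometric on generating tuples *)

Section ClosenessOfTuples.
Context {R : realType} {L : language} (K : category R L).

(** For positive [e] this is [dK K x y < e], freed of the infimum and the maximum. *)
Definition close_tuples n (e : R) (x y : @tupled R L n) : Prop :=
  exists (C : structure R L) (u : x -> C) (v : y -> C), joint_hom K u v /\
    forall i, mdist (u (tup x i)) (v (tup y i)) < e.

Lemma dK_ltP n (e : R) (x y : tupled n) : 0 < e ->
  (dK K x y < e%:E)%E <-> close_tuples e x y.
Proof.
move=> e0; split => [/ereal_inf_lt[_ [C [u [v [uv ->]]]]]|[C [u [v [uv H]]]]].
  rewrite lte_fin => lte; exists C, u, v; split => // i.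
  by apply: le_lt_trans lte; apply: le_bigmax.
apply: le_lt_trans (ereal_inf_lbound _) _; first by exists C, u, v; split.
by rewrite lte_fin; apply: bigmax_lt.
Qed.

Lemma close_tuples_sym n e (x y : tupled n) :
  close_tuples e x y -> close_tuples e y x.
Proof.
move=> [C [u [v [[uh vh] H]]]]; exists C, v, u; split => // i.
by rewrite metric_sym.
Qed.

Lemma close_tuples_le n d e (x y : tupled n) : d <= e ->
  close_tuples d x y -> close_tuples e x y.
Proof.
move=> de [C [u [v [uv H]]]]; exists C, u, v; split => // i.
exact: lt_le_trans de.
Qed.

Lemma close_tuples_refl n e (x : tupled n) : obj K x -> 0 < e ->
  close_tuples e x x.
Proof.
move=> ox e0; exists x, id, id; split; first by split; exact: hom_id.
by move=> i; rewrite mdistxx.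
Qed.

Lemma NAP_seq (A B1 B2 : structure R L) (i1 : A -> B1) (i2 : A -> B2)
    (s : seq A) (e : R) :
  NAP K -> hom K i1 -> hom K i2 -> 0 < e ->
  exists (C : structure R L) (e1 : B1 -> C) (e2 : B2 -> C), [/\ hom K e1, hom K e2 &
    forall a, a \in s -> mdist (e1 (i1 a)) (e2 (i2 a)) < e].
Proof.
move=> nap h1 h2 e0.
have fs : finite_set [set` s] by apply/finite_seqP; exists s.
have [C [e1 [e2 [[? ?] H]]]] := nap _ _ _ _ _ _ _ h1 h2 fs e0.
by exists C, e1, e2; split => // a sa; exact: H.
Qed.

(** NAP glues the two joint embeddings over [y]; the gap between [d + e] and [f] pays for its error
    on the entries of [y]. *)
Lemma close_tuples_trans n d e f (x y z : tupled n) : NAP K -> d + e < f ->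
  close_tuples d x y -> close_tuples e y z -> close_tuples f x z.
Proof.
move=> nap def [C [u [v [[uh vh] H]]]] [C' [u' [v' [[uh' vh'] H']]]].
have f0 : 0 < f - (d + e) by rewrite subr_gt0.
have [E [p [q [ph qh Hpq]]]] := NAP_seq (codom (tup y)) nap vh uh' f0.
exists E, (p \o u), (q \o v'); split; first by split; exact: hom_comp.
move=> i /=; have := Hpq _ (codom_f (tup y) i).
have [pd _ _] := hom_embedding ph; have [qd _ _] := hom_embedding qh.
have := H i; have := H' i; rewrite -(pd (u _)) -(qd (u' _)).
have := metric_triangle (p (u (tup x i))) (p (v (tup y i))) (q (v' (tup z i))).
have := metric_triangle (p (v (tup y i))) (q (u' (tup y i))) (q (v' (tup z i))).
by lra.
Qed.

(** Copies the arguments of a symbol to the leading positions, where [CCP] evaluates it; the entries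
    that remain behind keep the tuple generating. *)
Definition prepend q n (s : 'I_q -> 'I_n) (x : @tupled R L n) : tupled (q + n) :=
  Tupled (fun i => match fintype.split i with
                   | inl j => tup x (s j) | inr j => tup x j end).

Lemma tup_head_prepend q n (s : 'I_q -> 'I_n) (x : tupled n) :
  tup_head (prepend s x) = tup x \o s.
Proof.
apply/funext => i; rewrite /tup_head /prepend /=.
by rewrite -[lshift n i]/(unsplit (inl i)) unsplitK.
Qed.

Lemma tup_prepend_rshift q n (s : 'I_q -> 'I_n) (x : tupled n) j :
  tup (prepend s x) (rshift q j) = tup x j.
Proof. by rewrite /= -[rshift q j]/(unsplit (inr j)) unsplitK. Qed.

Lemma Kn_prepend q n (s : 'I_q -> 'I_n) (x : tupled n) :
  Kn K x -> Kn K (prepend s x).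
Proof.
move=> [ox gx]; split => //; apply: generated_superset gx => _ [j _ <-].
by exists (rshift q j) => //; rewrite tup_prepend_rshift.
Qed.

Lemma close_prepend q n (s : 'I_q -> 'I_n) e (x y : tupled n) :
  close_tuples e x y -> close_tuples e (prepend s x) (prepend s y).
Proof.
move=> [C [u [v [uv H]]]]; exists C, u, v; split => // i /=.
by case: fintype.split => j; exact: H.
Qed.

(** Alternation with the constant [x] makes Cauchyness of the images under [CCP] a comparison of
    [y k] with [x] itself. *)
Lemma alternating_dK_cauchy n (x : tupled n) (y : nat -> tupled n) :
  NAP K -> obj K x -> (forall k, close_tuples k.+1%:R^-1 x (y k)) ->
  dK_cauchy K (fun k => if odd k then x else y k).
Proof.
move=> nap ox xy e e0.
have [k0 Hk0] : exists k0 : nat, forall k, (k0 <= k)%N -> k.+1%:R^-1 < e / 3 :> R.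
  have e2 : 0 < e / 3 by rewrite divr_gt0.
  have [N _ HN] := near_infty_natSinv_lt (PosNum e2).
  by exists N => k /HN.
have xyk k : (k0 <= k)%N -> close_tuples (e / 3) x (y k).
  by move=> /Hk0/ltW/close_tuples_le; apply.
have e2e : e / 3 <= e by lra.
exists k0 => k l kk kl; apply/dK_ltP => //.
case: (odd k); case: (odd l).
- exact: close_tuples_refl.
- exact: close_tuples_le e2e (xyk _ kl).
- exact: close_tuples_le e2e (close_tuples_sym (xyk _ kk)).
- by apply: close_tuples_trans nap _ (close_tuples_sym (xyk _ kk)) (xyk _ kl); lra.
Qed.

End ClosenessOfTuples.

(** * Continuity of the symbols with respect to the pseudometric *)

Section ControlledContinuity.
Context {R : realType} {L : language} (K : category R L).
Hypotheses (nap : NAP K) (ccp : CCP K).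

(* A counterexample for every [d] would give a sequence whose alternation with
   [x] contradicts CCP. *)
Lemma no_bad_sequence n (x : tupled n) (Q : tupled n -> Prop) : Kn K x ->
  (forall u : nat -> tupled n, (forall k, Kn K (u k)) -> dK_cauchy K u ->
    exists k0, forall k l, (k0 <= k)%N -> (k0 <= l)%N ->
      u k = x -> Kn K (u l) -> Q (u l)) ->
  exists2 d : R, 0 < d & forall y, Kn K y -> close_tuples K d x y -> Q y.
Proof.
move=> Kx H; apply: contrapT => nd.
have /choice[y Hy] : forall k : nat, exists y,
    [/\ Kn K y, close_tuples K k.+1%:R^-1 x y & ~ Q y].
  move=> k; apply: contrapT => ny; apply: nd.
  exists k.+1%:R^-1; first by rewrite invr_gt0.
  by move=> y Ky xy; apply: contrapT => nQ; apply: ny; exists y.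
have xy k : close_tuples K k.+1%:R^-1 x (y k) by have [] := Hy k.
have [k0 Hk0] := H _ (fun k => match odd k as b return
    Kn K (if b then x else y k) with true => Kx | false =>
      let: And3 h _ _ := Hy k in h end)
  (alternating_dK_cauchy nap (proj1 Kx) xy).
(* At the odd index the sequence is [x], at the even one it is a counterexample. *)
have := Hk0 k0.*2.+1 k0.*2; rewrite /= !odd_double /=.
case: (Hy k0.*2) => Ky _ nQ Q0; apply: nQ; apply: Q0 => //.
  by rewrite -addnn -addnS leq_addr.
by rewrite -addnn leq_addr.
Qed.

Lemma rel_interp_controlled n (x : tupled n) (P : rel_symb L)
    (s : 'I_(rel_arity P) -> 'I_n) (e : R) : Kn K x -> 0 < e ->
  exists2 d : R, 0 < d & forall y, Kn K y -> close_tuples K d x y ->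
    `|rel_interp P (tup x \o s) - rel_interp P (tup y \o s)| < e.
Proof.
move=> Kx e0.
apply: (no_bad_sequence (Q := fun y =>
  `|rel_interp P (tup x \o s) - rel_interp P (tup y \o s)| < e)) => // u Ku cu.
have cpu : dK_cauchy K (fun k => prepend s (u k)).
  move=> d d0; have [k0 Hk0] := cu d d0; exists k0 => k l kk kl.
  by apply/dK_ltP => //; apply/close_prepend/dK_ltP => //; exact: Hk0.
have := ccp.1 P n _ (fun k => Kn_prepend s (Ku k)) cpu.
move=> /cauchyP/(_ (e / 2))[|r [k0 _ Hk0]]; first by rewrite divr_gt0.
exists k0 => k l kk kl uk _.
have := Hk0 k kk; have := Hk0 l kl; rewrite /ball /= !tup_head_prepend uk => rl rk.
have := ler_distD r (rel_interp P (tup x \o s)) (rel_interp P (tup (u l) \o s)).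
by rewrite (distrC _ r); lra.
Qed.

(** A value of [f] need not be an entry, so it is tested against an entry near it. The factor 3
    collects the errors for the values of [f], for the hypothesis on [x], and for the entries at
    [j]. *)
Lemma fun_interp_controlled n (x : tupled n) (f : fun_symb L)
    (s : 'I_(fun_arity f) -> 'I_n) (j : 'I_n) (e : R) : Kn K x -> 0 < e ->
  mdist (fun_interp f (tup x \o s)) (tup x j) < e ->
  exists2 d : R, 0 < d & forall y, Kn K y -> close_tuples K d x y ->
    mdist (fun_interp f (tup y \o s)) (tup y j) < 3 * e.
Proof.
move=> Kx e0 xj.
apply: (no_bad_sequence (Q := fun y : tupled n =>
  mdist (fun_interp f (tup y \o s)) (tup y j) < 3 * e)) => // u Ku cu.
have cpu : dK_cauchy K (fun k => prepend s (u k)).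
  move=> d d0; have [k0 Hk0] := cu d d0; exists k0 => k l kk kl.
  by apply/dK_ltP => //; apply/close_prepend/dK_ltP => //; exact: Hk0.
have [k0 Hk0] := ccp.2 f n _ (fun k => Kn_prepend s (Ku k)) cpu e e0.
exists k0 => k l kk kl uk _.
have := Hk0 k l kk kl; rewrite uk => /dK_ltP => /(_ e0).
move=> [C [p [q [[ph qh] H]]]].
have [pd _ _] := hom_embedding ph; have [qd _ _] := hom_embedding qh.
have Hf : mdist (p (fun_interp f (tup x \o s))) (q (fun_interp f (tup (u l) \o s))) < e.
  have := H (rshift (fun_arity f + n) ord0).
  by rewrite /= -[rshift _ _]/(unsplit (inr ord0)) unsplitK !tup_head_prepend.
have Hj : mdist (p (tup x j)) (q (tup (u l) j)) < e.
  have := H (lshift 1 (rshift _ j)).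
  rewrite /= -[lshift _ _]/(unsplit (inl (rshift _ j))) unsplitK.
  by rewrite -[rshift _ _]/(unsplit (inr j)) unsplitK.
move: xj; rewrite -pd -(qd (fun_interp f _)) => xj.
have := metric_triangle (q (fun_interp f (tup (u l) \o s)))
  (p (fun_interp f (tup x \o s))) (q (tup (u l) j)).
have := metric_triangle (p (fun_interp f (tup x \o s))) (p (tup x j)) (q (tup (u l) j)).
rewrite (metric_sym (q _) (p _)); lra.
Qed.

End ControlledContinuity.

(** * Isometries approximated on tuples by embeddings *)

Section ApproximateEmbedding.
Context {R : realType} {L : language} (K : category R L).
Hypotheses (nap : NAP K) (ccp : CCP K).
Context {N M : structure R L} {n : nat -> nat} (x : forall k, @tupled R L (n k))
  (e : forall k, x k -> N).
Hypotheses (Kx : forall k, Kn K (x k)) (emb : forall k, is_embedding (@e k))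
  (incr : forall k l, (k <= l)%N ->
    forall i, exists j, e (tup (x l) j) = e (tup (x k) i))
  (ex_close : forall z (d : R), 0 < d ->
    exists k i, mdist z (e (tup (x k) i)) < d).

Lemma close_subtuple q (a : 'I_q -> N) (d : R) k0 : 0 < d ->
  exists2 k, (k0 <= k)%N & exists s : 'I_q -> 'I_(n k),
    forall i, mdist (a i) (e (tup (x k) (s i))) < d.
Proof.
move=> d0; have /choice[kk Hkk] : forall i, exists k, exists j,
    mdist (a i) (e (tup (x k) j)) < d by move=> i; exact: ex_close.
pose k := maxn k0 (\max_i kk i); exists k; first exact: leq_maxl.
suff /choice[s Hs] : forall i, exists j, mdist (a i) (e (tup (x k) j)) < d.
  by exists s.
move=> i; have [j aj] := Hkk i.
have [|j' ej] := @incr (kk i) k _ j; last by exists j'; rewrite ej.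
by rewrite leq_max [X in _ || X](leq_bigmax i) orbT.
Qed.

(** Arguments are replaced by entries of some [x k], these by entries of [y], and these by the
    images under [iota]. The three comparisons use continuity in [N], CCP, and continuity in [M]. *)
Lemma approximate_embedding (iota : N -> M) :
  (forall y z, mdist (iota y) (iota z) = mdist y z) ->
  (forall k (d : R), 0 < d -> exists (y : tupled (n k)) (w : y -> M),
    [/\ Kn K y, is_embedding w, close_tuples K d (x k) y &
      forall i, mdist (iota (e (tup (x k) i))) (w (tup y i)) < d]) ->
  is_embedding iota.
Proof.
move=> iso H; split => //.
- move=> P a; apply/eqP; rewrite -subr_eq0 -normr_le0; apply/ler_addgt0Pl => c c0.
  rewrite addr0; have c3 : 0 < c / 3 by rewrite divr_gt0.
  have [d1 d10 H1] := rel_interp_close (iota \o a) c3.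
  have [d2 d20 H2] := rel_interp_close a c3.
  pose d := Num.min (d1 / 2) d2.
  have d0 : 0 < d by rewrite /d lt_min divr_gt0.
  have [dd1 dd2] : d <= d1 / 2 /\ d <= d2 by split; rewrite ge_min lexx ?orbT.
  have [k _ [s Hs]] := close_subtuple a 0 d0.
  have [d3 d30 H3] := rel_interp_controlled nap ccp s (Kx k) c3.
  pose d' := Num.min d d3; have d'0 : 0 < d' by rewrite /d' lt_min d0.
  have [d'd d'3] : d' <= d /\ d' <= d3 by split; rewrite ge_min lexx ?orbT.
  have [y [w [Ky [_ wr _] xy Hy]]] := H k _ d'0.
  have := H3 y Ky (close_tuples_le d'3 xy).
  have [_ er _] := @emb k.
  rewrite -wr -er.
  have := H2 (@e k \o (tup (x k) \o s)) (fun i => lt_le_trans (Hs i) dd2).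
  have := H1 (w \o (tup y \o s)); set p := rel_interp P _; set q := rel_interp P _.
  set r := rel_interp P _; set t := rel_interp P _ => A B C.
  have {}A : `|p - q| < c / 3.
    apply: A => i /=.
    have := metric_triangle (iota (a i)) (iota (e (tup (x k) (s i)))) (w (tup y (s i))).
    by rewrite iso; have := Hs i; have := Hy (s i); lra.
  have := ler_distD q p r; have := ler_distD t q r.
  rewrite (distrC q t) (distrC t r); lra.
- move=> f a; apply: mdist_le0 => c c0.
  (* Of the seven parts, three come from [fun_interp_controlled]; the others pay for continuity in
     [M], continuity in [N], the approximation of [iota] at the entry [j], and the distance of that
     entry from [z]. *)
  have c7 : 0 < c / 7 by rewrite divr_gt0.
  have [d1 d10 H1] := fun_interp_close (iota \o a) c7.
  have [d2 d20 H2] := fun_interp_close a c7.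
  pose d := Num.min (d1 / 2) d2.
  have d0 : 0 < d by rewrite /d lt_min divr_gt0.
  have [dd1 dd2] : d <= d1 / 2 /\ d <= d2 by split; rewrite ge_min lexx ?orbT.
  (* The arguments are approximated at stage [k1]; an entry near the value [z] on them may appear
     only at a later stage [k], where the arguments occur again by [incr]. *)
  have [k1 _ [s1 Hs1]] := close_subtuple a 0 d0.
  pose z := fun_interp f (@e k1 \o (tup (x k1) \o s1)).
  have [k kk1 [j' Hj]] := @close_subtuple 1 (fun=> z) _ k1 c7.
  pose j := j' ord0; have {}Hj : mdist z (e (tup (x k) j)) < c / 7 by exact: Hj.
  have /choice[s ss1] : forall i, exists j, e (tup (x k) j) = e (tup (x k1) (s1 i)).
    by move=> i; exact: incr.
  have zE : z = e (fun_interp f (tup (x k) \o s)).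
    have [_ _ ef] := @emb k; rewrite -ef /z; congr fun_interp.
    by apply/funext => i /=; rewrite ss1.
  have [ed _ ef] := @emb k.
  have [|d3 d30 H3] := @fun_interp_controlled _ _ _ nap ccp _ _ f s j _ (Kx k) c7.
    by rewrite -ed -zE.
  pose d' := Num.min (Num.min d d3) (c / 7).
  have d'0 : 0 < d' by rewrite lt_min c7 lt_min d0 d30.
  have [d'd d'3 d'c] : [/\ d' <= d, d' <= d3 & d' <= c / 7].
    by split; rewrite ge_min ?lexx ?orbT // ge_min lexx ?orbT.
  have [y [w [Ky [wd _ wf] xy Hy]]] := H k _ d'0.
  have h3 := H3 y Ky (close_tuples_le d'3 xy).
  have h2 := H2 (@e k1 \o (tup (x k1) \o s1)) (fun i => lt_le_trans (Hs1 i) dd2).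
  have h1 : mdist (fun_interp f (iota \o a)) (w (fun_interp f (tup y \o s))) < c / 7.
    rewrite -wf; apply: H1 => i /=.
    have := metric_triangle (iota (a i)) (iota (e (tup (x k) (s i)))) (w (tup y (s i))).
    by rewrite iso ss1; have := Hs1 i; have := Hy (s i); rewrite ss1; lra.
  have h4 := Hy j.
  move: h3 h2 Hj; rewrite -wd -/z -!iso => h3 h2 Hj.
  have := metric_triangle (fun_interp f (iota \o a)) (w (fun_interp f (tup y \o s))) (iota (fun_interp f a)).
  have := metric_triangle (w (fun_interp f (tup y \o s))) (w (tup y j)) (iota (fun_interp f a)).
  have := metric_triangle (w (tup y j)) (iota (e (tup (x k) j))) (iota (fun_interp f a)).
  have := metric_triangle (iota (e (tup (x k) j))) (iota z) (iota (fun_interp f a)).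
  rewrite (metric_sym (w (tup y j)) (iota (e _))) (metric_sym (iota (e _)) (iota z)).
  rewrite (metric_sym (iota z) (iota (fun_interp f a))).
  by lra.
Qed.

End ApproximateEmbedding.

(** * Enumerations and bookkeeping *)

Section Enumerations.
Context {R : realType} {L : language}.

Lemma dependent_choice_seq (T : Type) (P : nat -> T -> T -> Prop) (x0 : T) :
  (forall n x, exists y, P n x y) ->
  exists2 u : nat -> T, u 0%N = x0 & forall n, P n (u n) (u n.+1).
Proof.
move=> H; pose u := fix u n :=
  if n is k.+1 then sval (cid (H k (u k))) else x0.
by exists u => // n; exact: (svalP (cid (H n (u n)))).
Qed.

Lemma dense_mdist (X : metricType R) (D : set X) (x : X) (e : R) :
  dense D -> 0 < e -> exists2 y, D y & mdist x y < e.
Proof.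
move=> dD e0; have [|y [Bxy Dy]] := dD _ _ (@open_interior _ (ball x e)).
  by exists x; apply: nbhsx_ballx.
by exists y => //; have := interior_subset Bxy; rewrite ballEmdist.
Qed.

Lemma separable_seqs (A : structure R L) : separable A ->
  exists T : nat -> seq A, (forall r s, (r <= s)%N -> {subset T r <= T s}) /\
    forall x (e : R), 0 < e -> exists r y, y \in T r /\ mdist x y < e.
Proof.
move=> [D /countable_injP[f finj] dD].
(* [g] inverts the injection [f]; the option covers numbers not attained, and with them an empty
   [D]. *)
have /choice[g Hg] : forall k : nat, exists o : option A,
    forall y, D y -> f y = k -> o = Some y.
  move=> k; have [[y [Dy fy]]|nk] := pselect (exists y, D y /\ f y = k).
    exists (Some y) => z Dz fz; congr Some; apply: finj; rewrite ?inE //.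
    by rewrite fy.
  by exists None => y Dy fy; exfalso; apply: nk; exists y.
exists (fun r => pmap g (iota 0 r)); split => [r s rs y|x e e0].
  rewrite !mem_pmap => /mapP[k]; rewrite mem_iota /= add0n => kr ->.
  by apply/mapP; exists k => //; rewrite mem_iota /= add0n (leq_trans kr).
have [y Dy xy] := dense_mdist x dD e0.
exists (f y).+1, y; split => //; rewrite mem_pmap; apply/mapP.
by exists (f y); rewrite ?mem_iota ?add0n //= (Hg _ y).
Qed.

(** A schedule in which every pair recurs infinitely often, so that each task comes up after it was
    issued. *)
Definition visit (s : nat) : nat * nat := (logn 2 s.+1, logn 3 s.+1).

Lemma visitP m q s : exists2 s', (s <= s')%N & visit s' = (m, q).
Proof.
(* The power of 5 delays the visit beyond [s] without changing the exponents of 2 and 3. *)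
pose t := (2 ^ m * 3 ^ q * 5 ^ s)%N.
have t0 : (0 < t)%N by rewrite !muln_gt0 !expn_gt0.
exists t.-1.
  rewrite -ltnS prednK //; apply: leq_trans (ltn_expl s (isT : 1 < 5)%N) _.
  by rewrite leq_pmull // muln_gt0 !expn_gt0.
rewrite /visit prednK // /t !lognM ?muln_gt0 ?expn_gt0 // !lognX.
by rewrite !logn_prime //= !muln0 !muln1 !addn0.
Qed.

End Enumerations.

(** * Separability of the configurations over an object *)

Section Configurations.
Context {R : realType} {L : language} (K : category R L).
Hypotheses (nap : NAP K) (wpp : WPP K).
Implicit Types A : structure R L.

Record config (A : structure R L) (n : nat) := Config {
  cf_str : structure R L;
  cf_in : A -> cf_str;
  cf_tup : @tupled R L n;
  cf_emb : cf_tup -> cf_str }.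

Definition config_ok A n (X : config A n) : Prop :=
  [/\ hom K (@cf_in _ _ X), Kn K (cf_tup X) & hom K (@cf_emb _ _ X)].

Definition close_config A n (T : seq A) (e : R) (X Y : config A n) : Prop :=
  exists (E : structure R L) (u : cf_str X -> E) (v : cf_str Y -> E),
    [/\ joint_hom K u v,
        forall t, t \in T -> mdist (u (cf_in X t)) (v (cf_in Y t)) < e &
        forall i, mdist (u (cf_emb (tup (cf_tup X) i)))
                        (v (cf_emb (tup (cf_tup Y) i))) < e].

(** Encodes a configuration, seen on [T], as a tuple in [cf_str X], which brings it within reach of
    [WPP]; for a generator [c] the whole tuple generates. *)
Definition config_tuple A n (T : seq A) p (X : config A n)
    (c : 'I_p -> cf_str X) : @tupled R L (n + (size T + p)) :=
  Tupled (fun i => match fintype.split i with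
    | inl j => cf_emb (tup (cf_tup X) j)
    | inr k => match fintype.split k with
      | inl t => cf_in X (tnth (in_tuple T) t)
      | inr l => c l end end).

Lemma Kn_config_tuple A n (T : seq A) p (X : config A n)
    (c : 'I_p -> cf_str X) :
  config_ok X -> ordered_generator c -> Kn K (config_tuple T c).
Proof.
move=> [hX _ _] gc; split; first by case: (hom_obj hX).
apply: generated_superset gc => _ [l _ <-].
exists (rshift n (rshift (size T) l)) => //=.
by rewrite -[rshift n _]/(unsplit (inr _)) unsplitK
  -[rshift _ l]/(unsplit (inr l)) unsplitK.
Qed.

Lemma close_config_tuple A n (T : seq A) p (X Y : config A n)
    (c : 'I_p -> cf_str X) (d : 'I_p -> cf_str Y) (e : R) :
  close_tuples K e (config_tuple T c) (config_tuple T d) ->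
  close_config T e X Y.
Proof.
move=> [E [u [v [uv H]]]]; exists E, u, v; split => // [t tT|i].
  pose k := Ordinal (etrans (index_mem t T) tT).
  have := H (rshift n (lshift p k)).
  rewrite /= -[rshift n _]/(unsplit (inr _)) unsplitK.
  rewrite -[lshift p k]/(unsplit (inl k)) unsplitK.
  by rewrite (tnth_nth t) /= nth_index.
have := H (lshift (size T + p) i).
by rewrite /= -[lshift _ i]/(unsplit (inl i)) unsplitK.
Qed.

(** A dense family of tuples need not come from configurations over [A]. Each member is therefore
    replaced by some configuration close to it, if there is one, and closeness passes through that
    member. *)
Lemma config_separable_fixed A n (T : seq A) p (e : R) : 0 < e ->
  exists F : nat -> option (config A n),
    (forall q X, F q = Some X -> config_ok X) /\
    forall (X : config A n) (c : 'I_p -> cf_str X), config_ok X ->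
      ordered_generator c -> exists q Y, F q = Some Y /\ close_config T e X Y.
Proof.
move=> e0; have e3 : 0 < e / 3 by rewrite divr_gt0.
have [I [D [KD Ddense]]] := wpp (n + (size T + p)).
pose good i (X : config A n) := config_ok X /\ exists2 c : 'I_p -> cf_str X,
  ordered_generator c & close_tuples K (e / 3) (config_tuple T c) (D i).
have /choice[G HG] : forall i, exists o : option (config A n),
    (forall X, o = Some X -> good i X) /\ ((exists X, good i X) -> o <> None).
  move=> i; have [[X gX]|nX] := pselect (exists X, good i X).
    by exists (Some X); split => // Y [<-].
  by exists None; split => // gX; case: nX.
exists (fun q => if unpickle q is Some i then G i else None); split.
  move=> q X; case: unpickle => // i /(proj1 (HG i)).
  by case.
move=> X c okX gc.
have [i /dK_ltP Xi] := Ddense _ _ (Kn_config_tuple T okX gc) e3.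
have {}Xi := Xi e3.
case Gi : (G i) => [Y|]; last first.
  by case: (proj2 (HG i) _ Gi); exists X; split => //; exists c.
have [_ [d _ Yi]] := proj1 (HG i) _ Gi.
exists (pickle i), Y; rewrite pickleK; split => //.
apply: (close_config_tuple (c := c) (d := d)).
by apply: close_tuples_trans nap _ Xi (close_tuples_sym Yi); lra.
Qed.

(** The number [p] of generators of [cf_str X] varies with [X], so the families are united over
    [p]. *)
Lemma config_separable A n (T : seq A) (e : R) : 0 < e ->
  exists F : nat -> option (config A n),
    (forall q X, F q = Some X -> config_ok X) /\
    forall X, config_ok X -> exists q Y, F q = Some Y /\ close_config T e X Y.
Proof.
move=> e0; have /choice[F HF] := fun p => config_separable_fixed n T p e0.
exists (fun k => if unpickle k is Some (p, q) then F p q else None); split.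
  by move=> k X; case: unpickle => // -[p q]; exact: (proj1 (HF p)).
move=> X okX; have [/hom_obj[_ /obj_fg[p [c gc]]] _ _] := okX.
have [q [Y [FY XY]]] := proj2 (HF p) X c okX gc.
by exists (pickle (p, q)), Y; rewrite pickleK.
Qed.

(* A request to embed [dm_str] over [A] into a later object of the chain, up to
   [dm_eps] on [dm_pts]. *)
Record demand (A : structure R L) := Demand {
  dm_pts : seq A;
  dm_str : structure R L;
  dm_in : A -> dm_str;
  dm_eps : R }.

Definition demand_ok A (d : demand A) : Prop :=
  hom K (@dm_in _ d) /\ 0 < dm_eps d.

(** Countably many demands can match an arbitrary request only approximately: the configuration
    through [Y], the points [T] through a net [T'], and the error through a smaller [e']. *)
Definition enumerates_demands A (F : nat -> option (demand A)) : Prop :=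
  (forall q d, F q = Some d -> demand_ok d) /\
  forall n (X : config A n) (T : seq A) (e : R), config_ok X -> 0 < e ->
    exists q T' Y e', [/\ F q = Some (Demand T' (@cf_in _ _ Y) e'), config_ok Y,
      e' <= e, forall t, t \in T -> exists2 t', t' \in T' & mdist t t' < e &
      close_config T' e' X Y].

Lemma exists_demands A : obj K A ->
  exists F : nat -> option (demand A), enumerates_demands F.
Proof.
move=> oA; have [T [Tincr Tdense]] := separable_seqs (obj_separable oA).
have r0 r : 0 < r.+1%:R^-1 :> R by rewrite invr_gt0.
pose F r n := sval (cid (config_separable n (T r) (r0 r))).
have HF r n := svalP (cid (config_separable n (T r) (r0 r))).
exists (fun k => if unpickle k is Some (r, n, q) then
  omap (fun Y : config A n => Demand (T r) (@cf_in _ _ Y) r.+1%:R^-1)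
    (F r n q) else None); split.
  move=> k d; case: unpickle => // -[[r n] q].
  case FX : (F _ _) => [X|] //= [<-].
  by have [hX _ _] := proj1 (HF _ _) _ _ FX; split => //; exact: r0.
move=> n X S e okX e0.
have [N _ HN] := near_infty_natSinv_lt (PosNum e0).
have [r1 Hr1] : exists r, forall t, t \in S ->
    exists2 t', t' \in T r & mdist t t' < e.
  elim: S => [|s S [r IH]]; first by exists 0%N.
  have [r' [y [yr sy]]] := Tdense s e e0.
  exists (maxn r r') => t; rewrite inE => /orP[/eqP->|/IH[t' t'r tt']].
    by exists y => //; exact: (Tincr r' _ (leq_maxr _ _)).
  by exists t' => //; exact: (Tincr r _ (leq_maxl _ _)).
pose r := maxn r1 N.
have re : r.+1%:R^-1 <= e by apply/ltW/HN; rewrite /= leq_maxr.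
have [q [Y [FY XY]]] := proj2 (HF r n) X okX.
exists (pickle (r, n, q)), (T r), Y, r.+1%:R^-1; rewrite pickleK /= /F FY; split => //.
- exact: (proj1 (HF _ _) _ _ FY).
- move=> t /Hr1[t' t'r tt']; exists t' => //; exact: (Tincr r1 _ (leq_maxl _ _)).
Qed.

End Configurations.

(** * The chain that meets all demands *)

Section Chain.
Context {R : realType} {L : language} (K : category R L).
Implicit Types A B : structure R L.

(* A demand over an earlier object [tk_src] of the chain, carried to the current
   object [A]; keeping [tk_src] as data avoids transport along the chain. *)
Record task A := Task {
  tk_src : structure R L;
  tk_map : tk_src -> A;
  tk_pts : seq tk_src;
  tk_str : structure R L;
  tk_in : tk_src -> tk_str;
  tk_eps : R }.

Definition task_ok A (t : task A) : Prop :=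
  [/\ hom K (@tk_map _ t), hom K (@tk_in _ t) & 0 < tk_eps t].

Definition task_of_demand A (d : demand A) : task A :=
  Task (fun x : A => x) (dm_pts d) (@dm_in _ _ _ d) (dm_eps d).

Definition task_push A B (f : A -> B) (t : task A) : task B :=
  Task (f \o @tk_map _ t) (tk_pts t) (@tk_in _ t) (tk_eps t).

Definition performed A B (f : A -> B) (t : task A) : Prop :=
  exists2 h : tk_str t -> B, hom K h & forall x, x \in tk_pts t ->
    mdist (h (tk_in x)) (f (tk_map x)) < tk_eps t.

(** Along the chain, [sg_tasks m q] is the [q]-th demand issued at stage [m], carried to the current
    object, as soon as stage [m] has been reached. *)
Record stage := Stage {
  sg_str : structure R L;
  sg_obj : obj K sg_str;
  sg_demands : nat -> option (demand sg_str);
  sg_demandsP : enumerates_demands K sg_demands;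
  sg_tasks : nat -> nat -> option (task sg_str);
  sg_tasksP : forall m q t, sg_tasks m q = Some t -> task_ok t }.

Definition next_stage s (S T : stage) : Prop :=
  exists f : sg_str S -> sg_str T, [/\ hom K f,
    forall t, sg_tasks S (visit s).1 (visit s).2 = Some t -> performed f t &
    forall m q, sg_tasks T m q = if m == s.+1
      then omap (@task_of_demand _) (sg_demands T q)
      else omap (task_push f) (sg_tasks S m q)].

(** The image of [t] in the later object is described as the [t'] with the same image in [M], which
    avoids composites of the chain maps. *)
Definition realizes_configs (M : Kstructure K) : Prop :=
  forall m (C : structure R L) (a : ks_obj M m -> C) (T : seq (ks_obj M m)) n
    (x : tupled n) (b : x -> C) (e : R),
  0 < e -> hom K a -> hom K b -> Kn K x ->
  exists m' (E : structure R L) (u : C -> E) (v : ks_obj M m' -> E)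
      (y : tupled n) (w : y -> ks_obj M m'),
    [/\ [/\ (m < m')%N, hom K u, hom K v & hom K w], Kn K y,
      forall i, mdist (u (b (tup x i))) (v (w (tup y i))) < e &
      forall t t', t \in T -> ks_incl t' = ks_incl t -> mdist (u (a t)) (v t') < e].

Hypotheses (nap : NAP K) (wpp : WPP K).

Lemma task_of_demand_ok A (d : demand A) : obj K A -> demand_ok K d ->
  task_ok (task_of_demand d).
Proof. by move=> oA [hd e0]; split => //; exact: hom_id. Qed.

Lemma task_push_ok A B (f : A -> B) (t : task A) : hom K f -> task_ok t ->
  task_ok (task_push f t).
Proof. by move=> hf [hm hi e0]; split => //; exact: hom_comp. Qed.

Lemma performable A (o : option (task A)) : obj K A ->
  (forall t, o = Some t -> task_ok t) ->
  exists B (f : A -> B), hom K f /\ forall t, o = Some t -> performed f t.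
Proof.
case: o => [t|] oA H; last by exists A, id; split => //; exact: hom_id.
have [hm hi e0] := H t erefl.
have [B [h [f [hh hf close]]]] := NAP_seq (tk_pts t) nap hi hm e0.
by exists B, f; split => // _ [<-]; exists h.
Qed.

Lemma exists_next_stage s S : exists T, next_stage s S T.
Proof.
have [B [f [hf pf]]] := performable (sg_obj S) (@sg_tasksP S (visit s).1 (visit s).2).
have [_ oB] := hom_obj hf.
have [F HF] := exists_demands nap wpp oB.
pose tasks m q := if m == s.+1 then omap (@task_of_demand _) (F q)
  else omap (task_push f) (sg_tasks S m q).
have tasksP m q t : tasks m q = Some t -> task_ok t.
  rewrite /tasks; case: ifP => _.
    case Fq : (F q) => [d|] //= [<-].
    exact: task_of_demand_ok (proj1 HF _ _ Fq).
  case Sq : (sg_tasks S m q) => [d|] //= [<-].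
  exact: task_push_ok (sg_tasksP Sq).
exists (Stage oB HF tasksP).
by exists f; split.
Qed.

Lemma exists_initial_stage : (exists A, obj K A) ->
  exists S, forall q, sg_tasks S 0 q = omap (@task_of_demand _) (sg_demands S q).
Proof.
move=> [A oA]; have [F HF] := exists_demands nap wpp oA.
(* Only the entries with [m = 0] matter; those of a later [m] are overwritten when stage [m] is
   built. *)
pose tasks (m q : nat) := omap (@task_of_demand _) (F q).
have tasksP m q t : tasks m q = Some t -> task_ok t.
  rewrite /tasks; case Fq : (F q) => [d|] //= [<-].
  exact: task_of_demand_ok (proj1 HF _ _ Fq).
by exists (Stage oA HF tasksP).
Qed.

Section Limit.
Context (u : nat -> stage)
  (u0 : forall q, sg_tasks (u 0%N) 0 q = omap (@task_of_demand _) (sg_demands (u 0%N) q))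
  (f : forall s, sg_str (u s) -> sg_str (u s.+1))
  (fhom : forall s, hom K (@f s))
  (fperf : forall s t, sg_tasks (u s) (visit s).1 (visit s).2 = Some t ->
    performed (@f s) t)
  (ftasks : forall s m q, sg_tasks (u s.+1) m q = if m == s.+1
    then omap (@task_of_demand _) (sg_demands (u s.+1) q)
    else omap (task_push (@f s)) (sg_tasks (u s) m q))
  (M : structure R L) (incl : forall s, sg_str (u s) -> M)
  (lim : inductive_limit f incl).

Lemma own_tasks s q :
  sg_tasks (u s) s q = omap (@task_of_demand _) (sg_demands (u s) q).
Proof. by case: s => [|s]; rewrite ?u0 // ftasks eqxx. Qed.

(** Induction on the number [k] of stages left until the scheduled visit. By [m <= s] the task is
    pushed forward and never overwritten; distances are taken in [M], where the chain maps
    disappear. *)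
Lemma task_performed_later k s m q t : visit (s + k) = (m, q) -> (m <= s)%N ->
  sg_tasks (u s) m q = Some t ->
  exists s' (h : tk_str t -> sg_str (u s')), [/\ (s < s')%N, hom K h &
    forall x, x \in tk_pts t ->
      mdist (incl (h (tk_in x))) (incl (tk_map x)) < tk_eps t].
Proof.
have [ie ic _] := lim.
elim: k s t => [|k IH] s t vs ms st.
  have /fperf[h hh H] : sg_tasks (u s) (visit s).1 (visit s).2 = Some t.
    by move: vs; rewrite addn0 => ->.
  exists s.+1, h; split => // x xt; have [d _ _] := ie s.+1.
  by rewrite -(ic s) d; exact: H.
have vs1 : visit (s.+1 + k) = (m, q) by rewrite addSnnS.
have st1 : sg_tasks (u s.+1) m q = Some (task_push (@f s) t).
  by rewrite ftasks st ltn_eqF.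
have [s' [h [ss' hh H]]] := IH _ _ vs1 (leqW ms) st1.
exists s', h; split => //; first exact: ltn_trans ss'.
by move=> x xt; have := H x xt; rewrite /= ic.
Qed.

Definition chain_Kstructure : Kstructure K := KStructure fhom lim.

Lemma chain_realizes_configs : realizes_configs chain_Kstructure.
Proof.
have [ie ic _] := lim.
move=> m C a T n x b e e0 ha hb Kx.
(* Five errors: from [t] to a point [s'] of the net, from the given configuration to [Y], in the
   amalgamation below, in the performed task, and from [s'] back to [t]. *)
have e5 : 0 < e / 5 by rewrite divr_gt0.
have okX : config_ok K (Config a b) by split.
have [q [T' [Y [e' [Fq [hY KY hYe] e'e TT' [E1 [u1 [v1 [[hu1 hv1] HT' Hx]]]]]]]]] :=
  proj2 (@sg_demandsP (u m)) n _ T _ okX e5.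
have [s ms vs] := visitP m q m.
have tm : sg_tasks (u m) m q = Some (task_of_demand (Demand T' (@cf_in _ _ _ _ Y) e')).
  by rewrite own_tasks Fq.
have [m' [h [mm' /= hh Hh]]] := @task_performed_later (s - m) m m q _
  ltac:(by rewrite subnKC) (leqnn m) tm.
(* [cf_str Y] now embeds both in [E1], next to [C], and by [h] in the chain; the two are amalgamated
   over it. *)
have [E [p [v [hp hv Hpv]]]] := NAP_seq
  (map (@cf_in _ _ _ _ Y) T' ++ codom (fun i => cf_emb (tup (cf_tup Y) i)))
  nap hv1 hh e5.
have [pd _ _] := hom_embedding hp; have [vd _ _] := hom_embedding hv.
have [u1d _ _] := hom_embedding hu1; have [ad _ _] := hom_embedding ha.
have [id _ _] := ie m; have [id' _ _] := ie m'.
exists m', E, (p \o u1), v, (cf_tup Y), (h \o @cf_emb _ _ _ _ Y); split => //.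
- by split => //; exact: hom_comp.
- move=> i /=; have := Hx i; have := Hpv (cf_emb (tup (cf_tup Y) i)).
  rewrite mem_cat codom_f orbT => /(_ isT); rewrite -(pd (u1 _)) /=.
  have := metric_triangle (p (u1 (b (tup x i)))) (p (v1 (cf_emb (tup (cf_tup Y) i))))
    (v (h (cf_emb (tup (cf_tup Y) i)))).
  by lra.
- move=> t t' tT t't /=; have [s' s'T' ts'] := TT' t tT.
  have h1 : mdist (p (u1 (a t))) (p (u1 (a s'))) < e / 5 by rewrite pd u1d ad.
  have h2 : mdist (p (u1 (a s'))) (p (v1 (cf_in Y s'))) < e' by rewrite pd; exact: HT'.
  have h3 : mdist (p (v1 (cf_in Y s'))) (v (h (cf_in Y s'))) < e / 5.
    by apply: Hpv; rewrite mem_cat map_f.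
  have h4 : mdist (v (h (cf_in Y s'))) (v t') < e' + e / 5.
    have h5 : mdist (incl (h (cf_in Y s'))) (incl s') < e' := Hh s' s'T'.
    have h6 : mdist (incl s') (incl t) < e / 5 by rewrite id metric_sym.
    have h7 : incl t' = incl t := t't.
    rewrite vd -id' h7.
    by have := metric_triangle (incl (h (cf_in Y s'))) (incl s') (incl t); lra.
  have := metric_triangle (p (u1 (a t))) (p (u1 (a s'))) (v t').
  have := metric_triangle (p (u1 (a s'))) (p (v1 (cf_in Y s'))) (v t').
  have := metric_triangle (p (v1 (cf_in Y s'))) (v (h (cf_in Y s'))) (v t').
  by lra.
Qed.

End Limit.

Lemma exists_realizes_configs : has_inductive_limits K -> (exists A, obj K A) ->
  exists M : Kstructure K, realizes_configs M.
Proof.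
move=> hil /exists_initial_stage[S0 HS0].
have [u u0 Hu] := dependent_choice_seq S0 exists_next_stage.
pose f s := sval (cid (Hu s)).
have Hf s := svalP (cid (Hu s)).
have [|M [incl lim]] := hil _ f; first by move=> s; have [] := Hf s.
unshelve eexists (@chain_Kstructure u f _ M incl lim).
  by move=> s; have [] := Hf s.
apply: chain_realizes_configs.
- by rewrite u0.
- by move=> s; have [] := Hf s.
- by move=> s; have [] := Hf s.
Qed.

End Chain.

(** * Positions of the back-and-forth *)

Section Positions.
Context {R : realType} {L : language} (K : category R L).
Implicit Types N M : Kstructure K.

Lemma ks_obj_obj N k : obj K (ks_obj N k).
Proof. by have [] := hom_obj (ks_map_hom N k). Qed.

Lemma ks_incl_embedding N k : is_embedding (@ks_incl _ _ _ N k).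
Proof. by have [] := ks_limit N. Qed.

Lemma ks_incl_dist N k x y :
  mdist (@ks_incl _ _ _ N k x) (@ks_incl _ _ _ N k y) = mdist x y.
Proof. by have [] := ks_incl_embedding N k. Qed.

Lemma ks_incl_map N k x :
  @ks_incl _ _ _ N k.+1 (ks_map x) = @ks_incl _ _ _ N k x.
Proof. by have [] := ks_limit N. Qed.

Lemma ks_chain N j k : (j <= k)%N ->
  exists2 c : ks_obj N j -> ks_obj N k, hom K c &
    forall x, ks_incl (c x) = ks_incl x.
Proof.
elim: k => [|k IH]; rewrite leq_eqVlt => /orP[/eqP<-|//].
- by exists id => //; exact/hom_id/ks_obj_obj.
- by exists id => //; exact/hom_id/ks_obj_obj.
rewrite ltnS => /IH[c hc Hc]; exists (@ks_map _ _ _ N k \o c).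
  exact: hom_comp (ks_map_hom N k).
by move=> x /=; rewrite ks_incl_map Hc.
Qed.

Lemma ks_dense N (z : N) (d : R) : 0 < d ->
  exists k (y : ks_obj N k), mdist z (ks_incl y) < d.
Proof.
move=> d0; have [_ _ dn] := ks_limit N.
have [y [k _ [x _ <-]] zx] := dense_mdist z dn d0.
by exists k, x.
Qed.

Lemma exists_generating_seqs N : exists G : forall k, seq (ks_obj N k),
  [/\ forall k, generated [set` G k] = setT,
      forall k l, (k <= l)%N -> forall x, x \in G k ->
        exists2 y, y \in G l & ks_incl y = ks_incl x &
      forall (z : N) (d : R), 0 < d ->
        exists k y, y \in G k /\ mdist z (ks_incl y) < d].
Proof.
have Hg j : exists g : seq (ks_obj N j), generated [set` g] = setT.
  have [n [a ga]] := obj_fg (ks_obj_obj N j).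
  exists (codom a); apply: generated_superset ga => _ [i _ <-] /=.
  exact: codom_f.
pose g j := sval (cid (Hg j)).
have gT j : generated [set` g j] = setT := svalP (cid (Hg j)).
pose T j := sval (cid (separable_seqs (obj_separable (ks_obj_obj N j)))).
have TP j := svalP (cid (separable_seqs (obj_separable (ks_obj_obj N j)))).
(* The contribution of stage [j] to [G k]: generators make [G k] generating, and the nets growing
   with [k] make the union dense. *)
pose P j k := g j ++ T j k.
(* [G k] is specified by its image in [N], so that monotonicity can be read off there. *)
have HG k : exists G : seq (ks_obj N k), forall z,
    (exists2 y, y \in G & ks_incl y = z) <->
    (exists j, (j < k.+1)%N /\ exists2 y, y \in P j k & ks_incl y = z).
  have : (k.+1 <= k.+1)%N by [].
  elim: {1 3}k.+1 => [_|b IH bk].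
    by exists [::] => z; split => [[y]|[j []]].
  have [G HG] := IH (ltnW bk).
  have [c _ Hc] := @ks_chain N b k bk.
  exists (map c (P b k) ++ G) => z; split.
    move=> [y]; rewrite mem_cat => /orP[/mapP[x xP ->]|yG] <-.
      by exists b; split => //; exists x.
    have [|j [jb Hj]] := proj1 (HG (ks_incl y)); first by exists y.
    by exists j; split => //; exact: leqW.
  move=> [j []]; rewrite ltnS leq_eqVlt => /orP[/eqP->|jb] [y yP yz].
    by exists (c y); rewrite ?Hc // mem_cat map_f.
  have [|y' y'G y'z] := proj2 (HG z); first by exists j; split => //; exists y.
  by exists y' => //; rewrite mem_cat y'G orbT.
pose G k := sval (cid (HG k)).
have GP k := svalP (cid (HG k)).
exists G; split.
- move=> k; apply: generated_superset (gT k) => x xg /=.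
  have [|y yG yx] := proj2 (GP k (ks_incl x)).
    by exists k; split => //; exists x => //; rewrite mem_cat xg.
  by rewrite -(isometry_inj (@ks_incl_dist N k) yx).
- move=> k l kl x xG.
  have [|j [jk [y yP yx]]] := proj1 (GP k (ks_incl x)); first by exists x.
  apply/GP; exists j; split; first exact: leq_trans kl.
  exists y => //; move: yP; rewrite !mem_cat => /orP[->//|yT].
  by rewrite (proj1 (TP j) k l kl) ?orbT.
- move=> z d d0; have d2 : 0 < d / 2 by rewrite divr_gt0.
  have [j [x zx]] := ks_dense z d2.
  have [r [y [yT xy]]] := proj2 (TP j) x _ d2.
  have [|y' y'G y'y] := proj2 (GP (maxn j r) (ks_incl y)).
    exists j; split; first by rewrite ltnS leq_maxl.
    by exists y => //; rewrite mem_cat (proj1 (TP j) r) ?orbT ?leq_maxr.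
  exists (maxn j r), y'; split => //; rewrite y'y.
  have := metric_triangle z (ks_incl x) (ks_incl y); rewrite ks_incl_dist; lra.
Qed.

(* A stage of the back-and-forth; later stages have to preserve, up to small
   errors, the distances between [ps_lpts] and [ps_rpts]. *)
Record position N M := Position {
  ps_lvl : nat;
  ps_idx : nat;
  ps_str : structure R L;
  ps_left : ks_obj N ps_lvl -> ps_str;
  ps_right : ks_obj M ps_idx -> ps_str;
  ps_lpts : seq (ks_obj N ps_lvl);
  ps_rpts : seq (ks_obj M ps_idx);
  ps_left_hom : hom K ps_left;
  ps_right_hom : hom K ps_right }.

(** Points are named by their images in the limits, so that the same bound can be stated at
    different positions. *)
Definition within N M (s : position N M) (z : N) (y : M) (r : R) : Prop :=
  exists x x', [/\ x \in ps_lpts s, x' \in ps_rpts s, ks_incl x = z,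
    ks_incl x' = y & mdist (ps_left x) (ps_right x') <= r].

Definition next_position N M n (x : tupled n) (e : x -> N) (d : R)
    (s t : position N M) : Prop :=
  [/\ ps_lvl t = (ps_lvl s).+1, (ps_idx s < ps_idx t)%N,
      forall z y r, within s z y r -> within t z y (r + d) &
      exists (D : tupled n) (w : D -> ks_obj M (ps_idx t)),
        [/\ Kn K D, hom K w, close_tuples K d x D &
          forall i, within t (e (tup x i)) (ks_incl (w (tup D i))) d]].

(** First [M] realizes the configuration formed by [ps_str s] and the tuple [x] in it; then the next
    stage of [N] is amalgamated over the current one. Each move costs [d / 2]. *)
Lemma exists_next_position N M (s : position N M) n (x : tupled n)
    (c : x -> ks_obj N (ps_lvl s)) (d : R) :
  NAP K -> realizes_configs M -> 0 < d -> hom K c -> Kn K x ->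
  exists t, next_position (@ks_incl _ _ _ N _ \o c) d s t.
Proof.
move=> nap real d0 hc Kx; have d2 : 0 < d / 2 by rewrite divr_gt0.
have hl := ps_left_hom s; have hr := ps_right_hom s.
have [m [E [u [v [D [w [[im hu hv hw] KD HD Hr]]]]]]] :=
  real _ _ _ (ps_rpts s) _ x _ _ d2 hr (hom_comp hc hl) Kx.
have [G [p [q [hp hq Hpq]]]] := NAP_seq (ps_lpts s ++ codom (c \o tup x))
  nap (ks_map_hom N (ps_lvl s)) (hom_comp hl hu) d2.
have [f hf Hf] := @ks_chain M _ _ (ltnW im).
have [qd _ _] := hom_embedding hq; have [ud _ _] := hom_embedding hu.
have Hx i : mdist (p (ks_map (c (tup x i)))) (q (v (w (tup D i)))) < d.
  have := HD i; have := Hpq (c (tup x i)).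
  rewrite mem_cat codom_f orbT => /(_ isT); rewrite -(qd (u _)) /=.
  have := metric_triangle (p (ks_map (c (tup x i)))) (q (u (ps_left (c (tup x i)))))
    (q (v (w (tup D i)))).
  by lra.
exists (@Position N M _ m G p (q \o v)
  (map (@ks_map _ _ _ N _) (ps_lpts s ++ codom (c \o tup x)))
  (map f (ps_rpts s) ++ codom (w \o tup D)) hp (hom_comp hv hq)); split => //=.
- move=> z y r [a [b [al br az ay abr]]]; exists (ks_map a), (f b); split => /=.
  + by rewrite map_f // mem_cat al.
  + by rewrite mem_cat map_f.
  + by rewrite ks_incl_map.
  + by rewrite Hf.
  have := Hpq a; rewrite mem_cat al => /(_ isT) /=.
  have := Hr b (f b) br (Hf b).
  move: abr; rewrite -ud -qd -(qd (u (ps_right b))).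
  have := metric_triangle (p (ks_map a)) (q (u (ps_left a))) (q (v (f b))).
  have := metric_triangle (q (u (ps_left a))) (q (u (ps_right b))) (q (v (f b))).
  by lra.
- exists D, w; split => //.
    exists G, (p \o (@ks_map _ _ _ N _ \o c)), (q \o (v \o w)); split.
      by split; apply: hom_comp => //; apply: hom_comp => //; exact: ks_map_hom.
    exact: Hx.
  move=> i; exists (ks_map (c (tup x i))), (w (tup D i)); split => //=.
  + by rewrite map_f // mem_cat codom_f orbT.
  + by rewrite mem_cat codom_f orbT.
  + by rewrite ks_incl_map.
  exact/ltW/Hx.
Qed.

End Positions.

(** * The isometry defined by the back-and-forth *)

Section LimitMap.
Context {R : realType} {L : language} (K : category R L).

Lemma half_pow_small (e d : R) : 0 < e -> 0 < d ->
  exists k0 : nat, forall k, (k0 <= k)%N -> e / 2 ^+ k <= d.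
Proof.
move=> e0 d0; have de : 0 < d / e by rewrite divr_gt0.
have [k0 _ Hk0] := near_infty_natSinv_lt (PosNum de).
exists k0 => k /Hk0 /= kd.
rewrite mulrC -ler_pdivlMr //; apply/ltW/(le_lt_trans _ kd).
rewrite lef_pV2 ?posrE ?exprn_gt0 // -natrX ler_nat.
exact: ltn_expl.
Qed.

(** [Q e z y] is read as: [y] is the value at [z] up to [e]. Approximate values at one point form a
    Cauchy family, and the two-sided bound passes to their limits. *)
Lemma isometry_of_relation (X : metricType R) (M : structure R L)
    (Q : R -> X -> M -> Prop) :
  (forall e z, 0 < e -> exists y, Q e z y) ->
  (forall d e z z' y y', 0 < d -> 0 < e -> Q d z y -> Q e z' y' ->
    mdist y y' <= mdist z z' + (d + e) /\ mdist z z' <= mdist y y' + (d + e)) ->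
  exists2 iota : X -> M, forall z z', mdist (iota z) (iota z') = mdist z z' &
    forall e z y, 0 < e -> Q e z y -> mdist y (iota z) <= e.
Proof.
move=> Qex Qdist.
have /choice[iota Hi] : forall z, exists l, forall e y, 0 < e -> Q e z y ->
    mdist y l <= e.
  move=> z; apply: complete_family => [e e0|d e y y' d0 e0 Qy Qy'].
    exact: Qex.
  by have [] := Qdist _ _ _ _ _ _ d0 e0 Qy Qy'; rewrite mdistxx add0r.
exists iota => [z z'|e z y]; last exact: Hi.
apply/le_anti/andP; split; apply/ler_addgt0Pl => c c0;
  have c4 : 0 < c / 4 by [rewrite divr_gt0];
  have [y Qy] := Qex _ z c4; have [y' Qy'] := Qex _ z' c4;
  have [h1 h2] := Qdist _ _ _ _ _ _ c4 c4 Qy Qy';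
  have := Hi _ _ _ c4 Qy; have := Hi _ _ _ c4 Qy'.
- have := metric_triangle (iota z) y (iota z'); have := metric_triangle y y' (iota z').
  by rewrite (metric_sym (iota z) y); lra.
- have := metric_triangle y (iota z) y'; have := metric_triangle (iota z) (iota z') y'.
  by rewrite (metric_sym (iota z') y'); lra.
Qed.

Hypothesis nap : NAP K.
Context (N M : Kstructure K) (real : realizes_configs M)
  (G : forall k, seq (ks_obj N k))
  (Ggen : forall k, generated [set` G k] = setT)
  (Gdense : forall (z : N) (d : R), 0 < d ->
    exists k y, y \in G k /\ mdist z (ks_incl y) < d).
Implicit Types (s t : position N M) (u : nat -> position N M).

Definition gen_tuple k : @tupled R L (size (G k)) :=
  Tupled (tnth (in_tuple (G k))).

Lemma Kn_gen_tuple k : Kn K (gen_tuple k).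
Proof.
split; first exact: ks_obj_obj.
apply: generated_superset (Ggen k) => x /= xG.
exists (Ordinal (etrans (index_mem x (G k)) xG)) => //.
by rewrite (tnth_nth x) /= nth_index.
Qed.

(* [logn 2 k.+1] takes every value infinitely often. *)
Definition generic_step (e : R) k s t : Prop :=
  [/\ ps_lvl t = (ps_lvl s).+1, (ps_idx s < ps_idx t)%N,
      forall z y r, within s z y r -> within t z y (r + e / 2 ^+ k.+1) &
      (logn 2 k.+1 <= ps_lvl s)%N ->
      exists (D : tupled (size (G (logn 2 k.+1)))) (w : D -> ks_obj M (ps_idx t)),
        [/\ Kn K D, hom K w,
          close_tuples K (e / 2 ^+ k.+1) (gen_tuple (logn 2 k.+1)) D &
          forall i, within t (ks_incl (tup (gen_tuple (logn 2 k.+1)) i))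
            (ks_incl (w (tup D i))) (e / 2 ^+ k.+1)]].

Lemma exists_generic_step (e : R) k s : 0 < e -> exists t, generic_step e k s t.
Proof.
move=> e0; have d0 : 0 < e / 2 ^+ k.+1 by rewrite divr_gt0 // exprn_gt0.
have [ks|sk] := leqP (logn 2 k.+1) (ps_lvl s).
  have [c hc Hc] := ks_chain N ks.
  have [t [tl ti tw [D [w [KD hw cD Dw]]]]] :=
    @exists_next_position _ _ _ N M s _ (gen_tuple _) c _ nap real d0 hc
      (Kn_gen_tuple _).
  exists t; split => // _; exists D, w; split => // i.
  by rewrite -Hc; exact: Dw.
have [t [tl ti tw _]] := @exists_next_position _ _ _ N M s _ (gen_tuple _) id _
  nap real d0 (hom_id (ks_obj_obj N (ps_lvl s))) (Kn_gen_tuple (ps_lvl s)).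
by exists t; split => //; rewrite leqNgt sk.
Qed.

Section Sequence.
Context (e : R) (u : nat -> position N M) (e0 : 0 < e)
  (step : forall k, generic_step e k (u k) (u k.+1)).

Lemma lvl_ge k : (k <= ps_lvl (u k))%N.
Proof. by elim: k => // k IH; have [-> _ _ _] := step k. Qed.

Lemma idx_ge k : (k <= ps_idx (u k))%N.
Proof. by elim: k => // k IH; have [_ /(leq_ltn_trans IH)] := step k. Qed.

Lemma within_later k l z y r : (k <= l)%N -> within (u k) z y r ->
  within (u l) z y (r + e / 2 ^+ k).
Proof.
move=> kl wk.
(* The tail of the geometric series not yet spent is subtracted, which makes the bound inductive. *)
have wj j : within (u (j + k)%N) z y (r + e / 2 ^+ k - e / 2 ^+ (j + k)).
  elim: j => [|j IH]; first by rewrite add0n addrK.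
  have [_ _ /(_ _ _ _ IH) + _] := step (j + k).
  congr within; rewrite addSn exprS invfM mulrA.
  set a := e / 2 ^+ k; set b := e / 2 ^+ (j + k).
  have -> : e / 2 / 2 ^+ (j + k) = b / 2 by rewrite /b mulrAC.
  lra.
have [x [x' [xl xr xz xy H]]] := wj (l - k)%N; rewrite subnK // in x x' xl xr xz xy H *.
exists x, x'; split => //; apply: le_trans H _; rewrite lerBlDr lerDl.
by rewrite divr_ge0 ?ltW // exprn_gt0.
Qed.

Lemma generic_visit k0 k1 : exists k, [/\ (k1 <= k)%N, logn 2 k.+1 = k0 &
  (logn 2 k.+1 <= ps_lvl (u k))%N].
Proof.
have [k k1k [k0k _]] := visitP k0 0 k1.
exists k; split => //; apply: leq_trans (lvl_ge k).
by rewrite -ltnS; apply: leq_trans (ltn_expl _ (isT : 1 < 2)%N) (dvdn_leq _ (pfactor_dvdnn _ _)).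
Qed.

(** [y] is a value at [z] of the map under construction, up to [d]. Nearby points stand in for [z]
    and [y], which need not lie in any stage. *)
Definition tracks (d : R) (z : N) (y : M) : Prop :=
  exists k0, forall k, (k0 <= k)%N ->
    exists x y', [/\ mdist z (@ks_incl _ _ _ N (ps_lvl (u k)) x) <= d,
      mdist (@ks_incl _ _ _ M (ps_idx (u k)) y') y <= d &
      mdist (ps_left x) (ps_right y') <= d].

(** At a position late enough for both relations, distances in [N] and in [M] are compared inside
    [ps_str]; each relation contributes its three errors. *)
Lemma tracks_dist (d d' : R) z z' y y' :
  tracks d z y -> tracks d' z' y' ->
  mdist y y' <= mdist z z' + (3 * d + 3 * d') /\
  mdist z z' <= mdist y y' + (3 * d + 3 * d').
Proof.
move=> [k Hk] [k' Hk'].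
have [a [b [za ya ab]]] := Hk _ (leq_maxl k k').
have [a' [b' [za' ya' ab']]] := Hk' _ (leq_maxr k k').
move: ab ab' za ya za' ya'; set s := u _ => ab ab' za ya za' ya'.
have [ld _ _] := hom_embedding (ps_left_hom s).
have [rd _ _] := hom_embedding (ps_right_hom s).
have h1 := metric_triangle y (ks_incl b) y'.
have h2 := metric_triangle (ks_incl b) (ks_incl b') y'.
have h3 := metric_triangle (ps_right b) (ps_left a) (ps_right b').
have h4 := metric_triangle (ps_left a) (ps_left a') (ps_right b').
have h5 := metric_triangle (ks_incl a) z (ks_incl a').
have h6 := metric_triangle z z' (ks_incl a').
have g1 := metric_triangle z (ks_incl a) z'.
have g2 := metric_triangle (ks_incl a) (ks_incl a') z'.
have g3 := metric_triangle (ps_left a) (ps_right b) (ps_left a').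
have g4 := metric_triangle (ps_right b) (ps_right b') (ps_left a').
have g5 := metric_triangle (ks_incl b) y (ks_incl b').
have g6 := metric_triangle y y' (ks_incl b').
rewrite !ks_incl_dist !ld !rd in h1 h2 h3 h4 h5 h6 g1 g2 g3 g4 g5 g6.
rewrite (metric_sym y (ks_incl b)) in h1; rewrite (metric_sym _ (ps_left a)) in h3.
rewrite (metric_sym _ z) in h5; rewrite (metric_sym (ks_incl a') z') in g2.
rewrite (metric_sym (ps_right b') (ps_left a')) in g4.
rewrite (metric_sym y' (ks_incl b')) in g6.
by split; lra.
Qed.

Lemma generic_approximation k (d : R) : 0 < d ->
  exists (D : tupled (size (G k))) (w : D -> M),
    [/\ Kn K D, is_embedding w, close_tuples K d (gen_tuple k) D &
      forall i, tracks d (ks_incl (tup (gen_tuple k) i)) (w (tup D i))].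
Proof.
move=> d0; have [k1 Hk1] := half_pow_small e0 d0.
have [j [k1j jk jl]] := generic_visit k k1.
have [_ _ _] := step j; rewrite jk in jl * => /(_ jl)[D [w [KD hw cD Dw]]].
(* One summand is the error of realizing the tuple, the other bounds all later losses. *)
have dj : e / 2 ^+ j.+1 + e / 2 ^+ j.+1 <= d.
  apply: le_trans (Hk1 _ k1j).
  have -> : e / 2 ^+ j.+1 = e / 2 ^+ j / 2 by rewrite exprS invfM mulrA mulrAC.
  lra.
have j0 : 0 <= e / 2 ^+ j.+1 by rewrite divr_ge0 ?ltW // exprn_gt0.
exists D, (@ks_incl _ _ _ M _ \o w); split => //.
- exact: embedding_comp (hom_embedding hw) (ks_incl_embedding M _).
- by apply: close_tuples_le cD; lra.
- move=> i; exists j.+1 => l jl'.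
  have [x [y [_ _ xE yE xy]]] := within_later jl' (Dw i).
  exists x, y; rewrite xE yE !mdistxx; split; [exact: ltW|exact: ltW|].
  exact: le_trans xy dj.
Qed.

Lemma exists_tracks z (d : R) : 0 < d -> exists y, tracks d z y.
Proof.
move=> d0; have d2 : 0 < d / 2 by rewrite divr_gt0.
have [k [y [yG zy]]] := Gdense z d2.
have [D [w [_ _ _ H]]] := generic_approximation k d2.
pose i := Ordinal (etrans (index_mem y (G k)) yG).
have [k0 Hk0] := H i; exists (w (tup D i)), k0 => l /Hk0[a [b [ya ba ab]]].
exists a, b; split; [|by lra|by lra].
have iE : tup (gen_tuple k) i = y by rewrite /= (tnth_nth y) /= nth_index.
by have := metric_triangle z (ks_incl y) (ks_incl a); rewrite -{2}iE; lra.
Qed.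

Lemma exists_limit_map : exists iota : N -> M,
  [/\ forall y z, mdist (iota y) (iota z) = mdist y z,
      forall k (d : R), 0 < d -> exists (D : tupled (size (G k))) (w : D -> M),
        [/\ Kn K D, is_embedding w, close_tuples K d (gen_tuple k) D &
          forall i, mdist (iota (ks_incl (tup (gen_tuple k) i))) (w (tup D i)) < d],
      forall z y r, within (u 0%N) z y r -> mdist (iota z) y <= r + e &
      forall (s : seq (N * M)) (d : R), 0 < d -> exists t, forall p, p \in s ->
        exists (x : ks_obj N (ps_lvl t)) (y : ks_obj M (ps_idx t)),
        mdist p.1 (ks_incl x) + mdist (ps_left x) (ps_right y) +
          mdist (ks_incl y) p.2 <= mdist (iota p.1) p.2 + d].
Proof.
(* Division by 3 cancels the factor in [tracks_dist]. *)
have three (d : R) : 0 < d -> 0 < d / 3 by move=> d0; rewrite divr_gt0.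
have [d z /three/exists_tracks//|d d' z z' y y' d0 d'0 zy zy'|iota iso Hi] :=
  @isometry_of_relation N M (fun d => tracks (d / 3)).
  have := tracks_dist zy zy'.
  by rewrite !(mulrC 3) !divfK // pnatr_eq0.
exists iota; split => //.
- move=> k d d0; have d6 : 0 < d / 6 by rewrite divr_gt0.
  have [D [w [KD we cD H]]] := generic_approximation k d6.
  exists D, w; split => //; first by apply: close_tuples_le cD; lra.
  move=> i; have d2 : 0 < d / 2 by rewrite divr_gt0.
  have := Hi (d / 2) _ (w (tup D i)) d2.
  have -> : d / 2 / 3 = d / 6 by lra.
  by move=> /(_ _ (H i)); rewrite metric_sym; lra.
- move=> z y r w0; apply/ler_addgt0Pl => c c0.
  have c2 : 0 < c / 2 by rewrite divr_gt0.
  have [y' [k0 Hk0]] := exists_tracks z (three _ c2).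
  have := Hi _ _ _ c2 (ex_intro _ k0 Hk0).
  have [a [b [za by' ab]]] := Hk0 _ (leqnn k0).
  have [a' [b' [_ _ a'z b'y a'b']]] := within_later (leq0n k0) w0.
  have [ld _ _] := hom_embedding (ps_left_hom (u k0)).
  have [rd _ _] := hom_embedding (ps_right_hom (u k0)).
  move: za; rewrite -a'z ks_incl_dist -ld => za.
  rewrite -b'y.
  have := metric_triangle (iota (ks_incl a')) y' (ks_incl b').
  have := metric_triangle y' (ks_incl b) (ks_incl b').
  rewrite ks_incl_dist -(rd b b').
  have := metric_triangle (ps_right b) (ps_left a) (ps_right b').
  have := metric_triangle (ps_left a) (ps_left a') (ps_right b').
  rewrite (metric_sym (ps_right b) (ps_left a)) (metric_sym (ps_left a) (ps_left a')).
  rewrite (metric_sym y' (ks_incl b)) (metric_sym y' (iota _)).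
  move: a'b'; rewrite expr0 divr1; lra.
- move=> s d d0; have d8 : 0 < d / 8 by rewrite divr_gt0.
  suff [k0 Hk0] : exists k0, forall k, (k0 <= k)%N -> forall p, p \in s ->
      exists (x : ks_obj N (ps_lvl (u k))) (y : ks_obj M (ps_idx (u k))),
      mdist p.1 (ks_incl x) + mdist (ps_left x) (ps_right y) +
        mdist (ks_incl y) p.2 <= mdist (iota p.1) p.2 + d.
    by exists (u k0); exact: Hk0.
  elim: s => [|[z y] s [k1 IH]]; first by exists 0%N.
  have [y' [k2 Hk2]] := exists_tracks z (three _ d8).
  have h1 := Hi _ _ _ d8 (ex_intro _ k2 Hk2).
  (* [y] is unrelated to [iota z], so it is reached by density, at positions whose index is at least
     [k3]. *)
  have [k3 [y3 yy3]] := ks_dense y d8.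
  exists (maxn k1 (maxn k2 k3)) => k; rewrite !geq_max => /and3P[kk1 kk2 kk3] p.
  rewrite inE => /orP[/eqP->|]; last exact: IH.
  have [a [b [za by' ab]]] := Hk2 _ kk2.
  have [c _ Hc] := ks_chain M (leq_trans kk3 (idx_ge k)).
  exists a, (c y3) => /=; rewrite Hc.
  have [rd _ _] := hom_embedding (ps_right_hom (u k)).
  have := metric_triangle (ps_left a) (ps_right b) (ps_right (c y3)).
  rewrite rd -ks_incl_dist Hc.
  have := metric_triangle (ks_incl b) y' (ks_incl y3).
  have := metric_triangle y' (iota z) (ks_incl y3).
  have := metric_triangle (iota z) y (ks_incl y3).
  by rewrite (metric_sym (ks_incl y3)); lra.
Qed.

End Sequence.
End LimitMap.

(** * Strict approximate isometries and amalgamation *)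

Section StrictApproximateIsometries.
Context {R : realType} {L : language} (K : category R L).
Implicit Types A B C : structure R L.

(** The closure provides [psi1] in the interior of the set below [phi], and above an extended joint
    isometry. By [apx_nbhs_ext] that interior leaves room for a uniform shift [d], since a shifted
    extension is still Lipschitz. *)
Lemma stxK_lower (M N : Kstructure K) (phi : {ptws (M * N) -> \bar R}) :
  stxK phi ->
  exists n m (C : structure R L) (S : set (ks_obj M n)) (T : set (ks_obj N m))
      (iota : S -> C) (eta : T -> C) (d : R),
    [/\ finite_partial_iso K iota, finite_partial_iso K eta, 0 < d &
      forall p, (apx_ext (@ks_incl _ _ _ M n \o val) (@ks_incl _ _ _ N m \o val)
        (apx_of iota eta) p + d%:E <= phi p)%E].
Proof.
move=> [_ [psi [_ clpsi] [_ npsi]]].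
have [psi1 [[apsi1 [n [m [theta [[C [S [T [iota [eta [hi he thetaE]]]]]] le1]]]]] npsi1]] :=
  clpsi _ (nbhs_interior npsi).
have [s [d [psi' [d0 apsi' Upsi' Hpsi']]]] := apx_nbhs_ext apsi1 npsi1.
exists n, m, C, S, T, iota, eta, d; split => // p.
rewrite -(apx_ext_comp _ _ _ (@ks_incl_dist _ _ _ M n) (@ks_incl_dist _ _ _ N m)) -thetaE.
apply: le_trans (Upsi' apsi' p); move: p.
apply: Hpsi' => [p p'|p _]; last exact/leeD2r/le1.
apply: le_trans (leeD2r _ (apx_ext_lip _ _ _ p p')) _.
by rewrite addeAC -(addeA _ _ d%:E) addeAC.
Qed.

(** As [s] generates, [A] itself represents both generated substructures, through the identity and
    through [b]. *)
Lemma finite_partial_iso_restrict A C (b : A -> C) (s : seq A) :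
  hom K b -> generated [set` s] = setT ->
  finite_partial_iso K (fun x : [set` s] => b (val x)).
Proof.
move=> hb gs; have [bd _ _] := hom_embedding hb; have [oA _] := hom_obj hb.
split => [|x y|]; first by apply/finite_seqP; exists s.
  exact: bd.
exists A, A, id, b, id; split => //.
- by split; [exact: hom_id|rewrite gs; apply/seteqP; split => // x _; exists x].
- split => //; rewrite -(generated_embedding (hom_embedding hb) gs); congr generated.
  apply/seteqP; split => [_ [x xs <-]|_ [x _ <-]].
    by exists (exist _ x (mem_set xs)).
  by exists (val x) => //; exact: (set_mem (valP x)).
- by split; [exact: hom_id|exists id; split => //; exact: hom_id].
by move=> x z zx; congr b.
Qed.

Hypothesis nap : NAP K.

(** NAP is applied over the object generated by [S], included in [A] and sent to [C'] through its
    isomorphic copy in [C]. The map [h] allows a second amalgamation after a first. *)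
Lemma amalgamate_partial_iso A C C' (S : set A) (iota : S -> C) (h : C -> C')
    (d : R) : finite_partial_iso K iota -> hom K h -> 0 < d ->
  exists (E : structure R L) (b : A -> E) (g : C' -> E), [/\ hom K b, hom K g &
    forall x, mdist (b (val x)) (g (h (iota x))) < d].
Proof.
move=> [fS _ [D [D' [i [j [theta [[hi ri] [hj _] [ht _] ij]]]]]]] hh d0.
have [id _ _] := hom_embedding hi.
have [|E [b [g [[hb hg] H]]]] := nap (F := i @^-1` S) hi
  (hom_comp (hom_comp ht hj) hh) _ d0.
  by apply: finite_preimage => // x y _ _; exact: (isometry_inj id).
exists E, b, g; split => // x; have Sx : S (val x) := set_mem (valP x).
have [z _ zx] : range i (val x) by rewrite ri => T [_ ST _]; exact: ST.
have Fz : S (i z) by rewrite zx.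
by have := H z Fz; rewrite /= zx (ij _ _ zx).
Qed.

Lemma amalgamate_partial_isos A B C (S : set A) (T : set B) (iota : S -> C)
    (eta : T -> C) (d : R) :
  finite_partial_iso K iota -> finite_partial_iso K eta -> 0 < d ->
  exists (E : structure R L) (b : A -> E) (a : B -> E), [/\ hom K b, hom K a &
    forall x y, mdist (b (val x)) (a (val y)) <= mdist (iota x) (eta y) + d].
Proof.
move=> hi he d0; have d2 : 0 < d / 2 by rewrite divr_gt0.
have oC : obj K C.
  by case: hi => _ _ [D [D' [i [j [theta [_ [/hom_obj[_ oC] _] _ _]]]]]].
have [E1 [b [g [hb hg Hb]]]] := amalgamate_partial_iso hi (hom_id oC) d2.
have [E [a [g' [ha hg' Ha]]]] := amalgamate_partial_iso he hg d2.
exists E, (g' \o b), a; split => //; first exact: hom_comp.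
move=> x y; have [gd _ _] := hom_embedding hg; have [gd' _ _] := hom_embedding hg'.
have := Hb x; have := Ha y; rewrite -(gd (iota x)) -gd' -[X in _ <= X + _]gd' /=.
have := metric_triangle (g' (b (val x))) (g' (g (iota x))) (a (val y)).
have := metric_triangle (g' (g (iota x))) (g' (g (eta y))) (a (val y)).
by rewrite (metric_sym (a (val y))); lra.
Qed.

Lemma apx_of_id (X Y : metricType R) (iota : X -> Y) :
  (forall x y, mdist (iota x) (iota y) = mdist x y) ->
  apx X Y (apx_of iota (fun y : Y => y)).
Proof. by move=> iso; exact: (@apx_of_along R X Y X Y id id Y iota id). Qed.

(** A pointwise neighbourhood controls [psi] only on the finite [s]; its Lipschitz property spreads
    the bound to all points. One [d] pays for the neighbourhood, the other for the distance of
    [iota] from [theta]. *)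
Lemma apx_lhd_of_close (X Y : metricType R) (X' Y' : Type) (i : X' -> X)
    (j : Y' -> Y) (theta : X' * Y' -> R) (iota : X -> Y) (s : seq (X * Y))
    (phi : {ptws (X * Y) -> \bar R}) (d : R) : 0 < d ->
  (forall x y, mdist (iota x) (iota y) = mdist x y) ->
  (forall q, (i q.1, j q.2) \in s) ->
  (forall q, mdist (iota (i q.1)) (j q.2) <= theta q + d) ->
  (forall p, (apx_ext i j (fun q => (theta q)%:E) p + (2 * d)%:E <= phi p)%E) ->
  apx_lhd (apx_of iota (fun y : Y => y)) phi.
Proof.
move=> d0 iso qs close le; split; first exact: apx_of_id.
have : \forall psi \near (apx_of iota (fun y : Y => y) : {ptws (X * Y) -> \bar R}),
    forall p, p \in s -> (psi p < (mdist (iota p.1) p.2 + d)%:E)%E.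
  apply: (@near_seq _ _ _ s (fun p (psi : {ptws (X * Y) -> \bar R}) =>
    (psi p < (mdist (iota p.1) p.2 + d)%:E)%E) (nbhs_filter _)) => p _.
  apply: (@ptws_nbhs_eval _ _ _ p [set z | (z < (mdist (iota p.1) p.2 + d)%:E)%E]).
  suff : nbhs (mdist (iota p.1) p.2) (fun r => (r%:E < (mdist (iota p.1) p.2 + d)%:E)%E)
    by [].
  apply/nbhs_ballP; exists d => //= r; rewrite /ball /= lte_fin ltr_distlC.
  by move=> /andP[].
apply: (@filterS _ _ (nbhs_filter _)) => psi H apsi p; apply: le_trans (le p).
rewrite -leeBlDr //; apply: apx_ext_ge => q; rewrite leeBlDr //.
apply: le_trans (apx_lip p (i q.1, j q.2) apsi) _.
have /H/ltW/= := qs q; case: (psi _) => [r| |] //=; rewrite ?lee_fin.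
  by have := close q; lra.
by move=> _; exact: leNye.
Qed.

End StrictApproximateIsometries.

(** * Admissible embeddings below strict approximate isometries *)

Section Limit.
Context {R : realType} {L : language} (K : category R L).
Hypothesis nap : NAP K.

Lemma exists_admissible (N M : Kstructure K) (phi : {ptws (N * M) -> \bar R}) :
  CCP K -> realizes_configs M -> stxK phi ->
  exists2 iota : N -> M,
    admissible iota & apx_lhd (apx_of iota (fun y : M => y)) phi.
Proof.
move=> ccp real /stxK_lower[n [m [C [S [T [iota [eta [d [hi he d0 Hphi]]]]]]]]].
(* The amalgamation and the back-and-forth lose [d / 4] each; the remaining [d / 2] is the
   neighbourhood required by [apx_lhd_of_close]. *)
have d4 : 0 < d / 4 by rewrite divr_gt0.
have [E [b [a [hb ha Hba]]]] := amalgamate_partial_isos nap hi he d4.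
have [/finite_seqP[s sS] _ _] := hi; have [/finite_seqP[t tT] _ _] := he.
have Ss z : S z -> z \in s by rewrite sS.
have Tt z : T z -> z \in t by rewrite tT.
have [G [Ggen Gincr Gdense]] := exists_generating_seqs N.
have [u u0 Hu] := dependent_choice_seq (Position s t hb ha)
  (fun k p => exists_generic_step nap real Ggen k p d4).
have [f [iso approx init grid]] := exists_limit_map Gdense d4 Hu.
exists f; last first.
  apply: (@apx_lhd_of_close _ _ _ _ _ (@ks_incl _ _ _ N n \o val)
    (@ks_incl _ _ _ M m \o val) (fun q => mdist (iota q.1) (eta q.2)) f
    [seq (ks_incl x, ks_incl y) | x <- s, y <- t] _ (d / 2)) => //.
  - by rewrite divr_gt0.
  - move=> q; apply/allpairsP; exists (val q.1, val q.2); split => //=.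
      exact: Ss (set_mem (valP q.1)).
    exact: Tt (set_mem (valP q.2)).
  - move=> q; have := Hba q.1 q.2.
    suff w : within (u 0%N) (ks_incl (val q.1)) (ks_incl (val q.2))
        (mdist (b (val q.1)) (a (val q.2))) by have := init _ _ _ w => /=; lra.
    rewrite u0; exists (val q.1), (val q.2); split => //=.
      exact: Ss (set_mem (valP q.1)).
    exact: Tt (set_mem (valP q.2)).
  - by move=> p; have := Hphi p; have -> : 2 * (d / 2) = d by lra.
split.
  apply: (@approximate_embedding _ _ K nap ccp N M (fun k => size (G k))
    (fun k => gen_tuple G k) (fun k => @ks_incl _ _ _ N k)) => //.
  - by move=> k; exact: Kn_gen_tuple.
  - by move=> k; exact: ks_incl_embedding.
  - move=> k l kl i; have [y yG yx] := Gincr _ _ kl _ (mem_tnth i (in_tuple (G k))).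
    exists (Ordinal (etrans (index_mem y (G l)) yG)).
    by rewrite /= (tnth_nth y) /= nth_index.
  - move=> z c c0; have [k [y [yG zy]]] := Gdense z c c0.
    exists k, (Ordinal (etrans (index_mem y (G k)) yG)).
    by rewrite /= (tnth_nth y) /= nth_index.
split; first exact: apx_of_id.
move=> U /(apx_nbhs_ext (apx_of_id iso))[q [c [psi [c0 apsi Upsi Hpsi]]]].
exists psi; split => //; split => //.
have [p Hp] := grid q c c0.
have [xs [ys Hxy]] : exists (xs : seq (ks_obj N (ps_lvl p)))
    (ys : seq (ks_obj M (ps_idx p))), forall z, z \in q -> exists x y,
    [/\ x \in xs, y \in ys & mdist z.1 (ks_incl x) +
      mdist (ps_left x) (ps_right y) + mdist (ks_incl y) z.2 <= mdist (f z.1) z.2 + c].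
  elim: q Hp {Hpsi} => [_|z q IH Hp]; first by exists [::], [::].
  have [|xs [ys H]] := IH; first by move=> w wq; apply: Hp; rewrite inE wq orbT.
  have [x [y xy]] := Hp z (mem_head _ _).
  exists (x :: xs), (y :: ys) => w; rewrite inE => /orP[/eqP->|/H[x' [y' [xx yy xy']]]].
    by exists x, y; rewrite !mem_head.
  by exists x', y'; rewrite !inE xx yy !orbT.
have [G' [G'gen _ _]] := exists_generating_seqs M.
(* [xs] and [ys] carry the approximation on the grid; the added generators turn the restrictions of
   [ps_left] and [ps_right] into finite partial isomorphisms. *)
pose S' := G (ps_lvl p) ++ xs; pose T' := G' (ps_idx p) ++ ys.
have gS : generated [set` S'] = setT.
  by apply: generated_superset (Ggen _) => x /= xG; rewrite mem_cat xG.
have gT : generated [set` T'] = setT.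
  by apply: generated_superset (G'gen _) => x /= xG; rewrite mem_cat xG.
exists (ps_lvl p), (ps_idx p), (apx_ext val val
  (apx_of (fun x : [set` S'] => ps_left (val x)) (fun y : [set` T'] => ps_right (val y)))).
split.
  exists (ps_str p), [set` S'], [set` T'], (fun x => ps_left (val x)),
    (fun y => ps_right (val y)); split => //.
  - exact: finite_partial_iso_restrict (ps_left_hom p) gS.
  - exact: finite_partial_iso_restrict (ps_right_hom p) gT.
apply: Hpsi => [z z'|z zq]; first exact: apx_ext_lip.
have [x [y [xx yy xy]]] := Hxy z zq.
have xS : [set` S'] x by rewrite /= mem_cat xx orbT.
have yT : [set` T'] y by rewrite /= mem_cat yy orbT.
rewrite (apx_ext_comp _ _ _ (@ks_incl_dist _ _ _ N _) (@ks_incl_dist _ _ _ M _)).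
apply: le_trans (apx_ext_le _ _ _ z (exist _ x (mem_set xS), exist _ y (mem_set yT))) _.
by rewrite /apx_of /= -!EFinD lee_fin.
Qed.

End Limit.

Theorem theorem4p7 (R : realType) (L : language) (K : category R L) :
  has_inductive_limits K -> fraisse_category K ->
  exists M : Kstructure K, fraisse_limit M.
Proof.
move=> hil [ne [_ nap wpp ccp]].
have [M real] := exists_realizes_configs nap wpp hil ne.
by exists M => N phi; exact: exists_admissible.
Qed.
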